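(* (i) The function $s^x$ does not depend on $x\in\mathbb R^n$; denote it by $s$. The function $s$ is convex, for every $x\in\mathbb R^n$ and $q\in\mathbb R$ $$s(q)=\lim_{T\to\infty}\frac{S^{xx}_T(q)}{T},$$ and $s(q)-s(-q)=-q$ for all $q\in\mathbb R$. (ii) Let $\{x_T\}_{T>0}\subset\mathbb R^n$ be bounded and let $s_T(q):=T^{-1}S^{x_T}_T(q)$. Then, as $T\to\infty$, $s_T$ $\Gamma$-converges to $s$; that is, for every $q\in\mathbb R$ and every sequence $T_n\to\infty$: for every sequence $q_n\to q$ one has $\liminf_n s_{T_n}(q_n)\ge s(q)$, and there exists a sequence $q_n\to q$ with $\limsup_n s_{T_n}(q_n)\le s(q)$.
   Context: Standing assumptions: $V\in C^2(\mathbb R^n;\mathbb R)$ satisfies $\lim_{|x|\to\infty}\langle\nabla V(x),x\rangle/|x|=+\infty$; $b:\mathbb R^n\to\mathbb R^n$ is a $C^1$, bounded vector field with bounded first derivatives, not conservative (not a gradient field); and $\langle\nabla V(x),b(x)\rangle=0$ for every $x$. Set $c:=-\tfrac12\nabla V+b$. For $T>0$: $H_T$ is the set of absolutely continuous $\varphi:[0,T]\to\mathbb R^n$ with $\int_0^T|\dot\varphi_t|^2dt<\infty$, $H^x_T:=\{\varphi\in H_T:\varphi_0=x\}$; $I^x_T(\varphi):=\frac12\int_0^T|\dot\varphi_t-c(\varphi_t)|^2dt$ if $\varphi\in H^x_T$, $+\infty$ otherwise; $\mathcal L_T(\varphi):=\frac2T\int_0^T\langle b(\varphi_t),\dot\varphi_t\rangle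 dt$; $\mathcal A^x_T(q):=\{\varphi\in H^x_T:\mathcal L_T(\varphi)=q\}$, $\mathcal A^{xy}_T(q):=\{\varphi\in\mathcal A^x_T(q):\varphi_T=y\}$; $S^{xy}_T(q):=\inf\{I^x_T(\varphi):\varphi\in\mathcal A^{xy}_T(q)\}$, $S^x_T(q):=\inf_{y}S^{xy}_T(q)=\inf\{I^x_T(\varphi):\varphi\in\mathcal A^x_T(q)\}$, and $s^x(q):=\inf_{T>0}\frac1TS^{xx}_T(q)$. *)

(* Defs.v *)
From HB Require Import structures.
From mathcomp Require Import all_boot all_order all_algebra.
From mathcomp Require Import all_classical all_reals all_analysis.
Set Implicit Arguments. Unset Strict Implicit. Unset Printing Implicit Defensive.
Import Order.TTheory GRing.Theory Num.Theory.
Import numFieldNormedType.Exports.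
Local Open Scope classical_set_scope.
Local Open Scope ring_scope.

Section Defs.
Variables (R : realType) (n : nat).
Notation vec := 'rV[R]_n.

Definition dotv (u v : vec) : R := \sum_(i < n) u 0 i * v 0 i.
Definition enorm (u : vec) : R := Num.sqrt (dotv u u).

Definition evec (i : 'I_n) : vec := delta_mx 0 i.
Definition partial (f : vec -> R) (i : 'I_n) (x : vec) : R := 'D_(evec i) f x.

Definition grad (f : vec -> R) (x : vec) : vec := \row_i partial f i x.

Definition C1 (f : vec -> R) : Prop :=
  (forall x i, derivable f x (evec i)) /\ (forall i, continuous (partial f i)).

Definition C2 (f : vec -> R) : Prop := C1 f /\ (forall i, C1 (partial f i)).

Definition C1field (b : vec -> vec) : Prop := forall j, C1 (fun x => b x 0 j).

Definition bounded_field (b : vec -> vec) : Prop :=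
  exists M : R, forall x, enorm (b x) <= M.

Definition bounded_first_derivatives (b : vec -> vec) : Prop :=
  exists M : R, forall x i j, `| partial (fun y => b y 0 j) i x | <= M.

Definition gradient_field (b : vec -> vec) : Prop :=
  exists U : vec -> R, forall x, (forall i, derivable U x (evec i)) /\ grad U x = b x.

Definition coercive_growth (V : vec -> R) : Prop :=
  forall M : R, exists r : R, forall x, r < enorm x ->
    M < dotv (grad V x) x / enorm x.

Definition cfield (V : vec -> R) (b : vec -> vec) (x : vec) : vec :=
  - (2^-1 *: grad V x) + b x.

Definition abs_cont_on (a bb : R) (phi : R -> vec) : Prop :=
  forall eps : R, 0 < eps -> exists delta : R, 0 < delta /\
    forall (N : nat) (l r : nat -> R),
      (forall k, (k < N)%N -> a <= l k /\ l k <= r k /\ r k <= bb) ->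
      (forall k m, (k < N)%N -> (m < N)%N -> k <> m -> r k <= l m \/ r m <= l k) ->
      \sum_(k < N) (r k - l k) < delta ->
      \sum_(k < N) enorm (phi (r k) - phi (l k)) < eps.

Definition sqn (u : vec) : R := dotv u u.

Local Notation mu := (@lebesgue_measure R).

(** H_T and H_T^x (paths are functions R -> R^n; only [0,T] matters). *)
Definition HT (T : R) (phi : R -> vec) : Prop :=
  abs_cont_on 0 T phi /\
  (\int[mu]_(t in `[0%R, T]) (sqn (derive1 phi t))%:E < +oo)%E.

Definition HTx (x : vec) (T : R) (phi : R -> vec) : Prop := HT T phi /\ phi 0 = x.

Definition IT (V : vec -> R) (b : vec -> vec) (x : vec) (T : R) (phi : R -> vec)
  : \bar R :=
  if `[< HTx x T phi >] then
    ((2^-1)%:E * \int[mu]_(t in `[0%R, T]) (sqn (derive1 phi t - cfield V b (phi t)))%:E)%E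
  else +oo%E.

Definition LT (b : vec -> vec) (T : R) (phi : R -> vec) : R :=
  2 / T * \int[mu]_(t in `[0%R, T]) dotv (b (phi t)) (derive1 phi t).

Definition AT (b : vec -> vec) (x : vec) (T q : R) : set (R -> vec) :=
  [set phi | HTx x T phi /\ LT b T phi = q].

Definition ATxy (b : vec -> vec) (x y : vec) (T q : R) : set (R -> vec) :=
  [set phi | AT b x T q phi /\ phi T = y].

Definition STxy (V : vec -> R) (b : vec -> vec) (x y : vec) (T q : R) : \bar R :=
  ereal_inf [set IT V b x T phi | phi in ATxy b x y T q].

Definition STx (V : vec -> R) (b : vec -> vec) (x : vec) (T q : R) : \bar R :=
  ereal_inf [set IT V b x T phi | phi in AT b x T q].

Definition sx (V : vec -> R) (b : vec -> vec) (x : vec) (q : R) : \bar R :=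
  ereal_inf [set (STxy V b x x T q * (T^-1)%:E)%E | T in [set T : R | 0 < T]].

End Defs.

(* Main.v *)
Require Import Defs.
From HB Require Import structures.
From mathcomp Require Import all_boot all_order all_algebra.
From mathcomp Require Import all_classical all_reals all_analysis.
From mathcomp Require Import measurable_realfun ring lra.
Import Order.TTheory GRing.Theory Num.Theory.
Import numFieldNormedType.Exports.
Set Implicit Arguments. Unset Strict Implicit. Unset Printing Implicit Defensive.
Local Open Scope classical_set_scope.
Local Open Scope ring_scope.

(* Paths are handled as integrals of square integrable velocities: the total
   variation of an absolutely continuous function defines a Stieltjes measure
   dominated by Lebesgue measure, so Radon-Nikodym and Lebesgue differentiation
   produce the velocity.

   Since [grad V . b = 0], the action of a path is a time-reversal invariant
   energy plus half the increment of [V] minus the work of [b]; reversing loops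
   gives [s q - s (- q) = - q]. Because [b] is not a gradient it has nonzero
   circulation along some triangle; scaling that triangle down (intermediate
   value theorem) and reversing it gives loops at [0] of arbitrarily short
   duration with any prescribed small work, so any work of order [T] can be
   produced by a loop at [0] in time [T] at cost [O(T)]. Repeating a loop and
   correcting its work this way yields independence of the base point,
   convexity, existence of the limit and the Gamma-limsup inequality.

   For the Gamma-liminf inequality, a path of cost [O(T)] has energy [O(T)],
   hence at some time of [[(1 - d) T, T]] its [grad V] is bounded and, by
   coercivity, its position too. Cutting it there changes its work by little,
   and segments followed by a correcting loop of duration [th T] turn it into a
   loop at [0] whose cost bounds [s] from above. *)

(** * Integrals off null sets and under affine changes of variable *)

(** [derive1 phi] carries information only almost everywhere, so the functionals of the statement
    are first rewritten, off a null set, with a velocity [g] that is given at every time ([prim]).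
    Afterwards the bookkeeping is done with the work [l = q * T / 2] and not with [q]: work adds up
    when paths are concatenated ([reach]). The obstacle in the lower bound is the free endpoint in
    [STx]: a path may end arbitrarily far away, from where a return to 0 has no uniform price. The
    passage from action to energy survives this because [V] is bounded below at the endpoint and
    bounded on the ball of starting points. Dropping the tail of a path can only lower its action,
    so only the lost work has to be paid for; Young's inequality measures it. Correcting loops are
    cheap for one reason: the range [kappa] of work in [exists_small_loops] is the same for all
    durations, so many short loops fit into a fixed time. *)

Section NullSets.
Context d (T : measurableType d) (R : realType)
  (mu : {measure set T -> \bar R}).
Import HBNNSimple.
Local Open Scope ereal_scope.

(** A simple function below [u], multiplied by the indicator of the complement of [N], is a simple
    function below [v] with the same integral. *)
Lemma ge0_le_integral_off_null (N : set T) (u v : T -> \bar R) :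
  measurable N -> mu N = 0 -> (forall x, 0 <= u x) -> (forall x, 0 <= v x) ->
  (forall x, ~ N x -> u x = v x) -> \int[mu]_x u x <= \int[mu]_x v x.
Proof.
move=> mN N0 u0 v0 uv; rewrite [leLHS]ge0_integralTE//.
apply: ge_ereal_sup => _ [h /= hu <-].
have mCN := measurableC mN.
pose h' := mul_nnsfun h (indic_nnsfun R mCN).
rewrite -integralT_nnsfun.
rewrite (_ : \int[mu]_x (h x)%:E = \int[mu]_x (h' x)%:E); last first.
  apply: ae_eq_integral => //.
  - exact/measurable_EFinP.
  - exact/measurable_EFinP.
  - exists N; split => // x /= /not_implyP[_ hx].
    apply: contrapT => nN; apply: hx.
    by rewrite /= /mindic indicE mem_set// mulr1.
rewrite integralT_nnsfun ge0_integralTE//.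
apply: ereal_sup_ubound; exists h' => // x /=; rewrite /mindic indicE.
have [Nx|nNx] := pselect (N x).
  by rewrite memNset ?mulr0// => /(_ Nx).
by rewrite mem_set// mulr1 -uv.
Qed.

(* No measurability is required of [f] and [g]: the integral of a nonnegative
   function is a supremum over simple functions below it. *)
Lemma integral_eq_off_null (D N : set T) (f g : T -> \bar R) :
  measurable N -> mu N = 0 -> (forall x, D x -> ~ N x -> f x = g x) ->
  \int[mu]_(x in D) f x = \int[mu]_(x in D) g x.
Proof.
move=> mN N0 fg; rewrite integralE [RHS]integralE.
by congr (_ - _); rewrite integral_mkcond [RHS]integral_mkcond;
  apply/eqP; rewrite eq_le; apply/andP; split;
  apply: (ge0_le_integral_off_null mN N0) => x;
  rewrite ?erestrict_ge0// => Nx; rewrite !patchE; case: ifPn => // /set_mem Dx;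
  by rewrite ?(funeposE, funenegE) fg.
Qed.

End NullSets.

Section Affine.
Context {R : realType}.
Local Notation mu := (@lebesgue_measure R).
Variables (k h : R).
Hypothesis k0 : k != 0.
Let phi (t : measurableTypeR R) : measurableTypeR R := k * t + h.

Lemma measurable_affine : measurable_fun [set: measurableTypeR R] phi.
Proof.
apply: continuous_measurable_fun => x; apply: cvgD; last exact: cvg_cst.
by apply: cvgMr; exact: cvg_id.
Qed.

(** The pushforward of [mu] scaled by the absolute value of [k] gives []a, b]] its length, so
    uniqueness of Lebesgue measure identifies the two. For negative [k] the preimage is closed on
    the left instead, with the same length. *)
Lemma lebesgue_measure_affine (A : set R) : measurable A ->
  (`|k|%:E * mu (phi @^-1` A) = mu A)%E.
Proof.
move=> mA.
pose psi : {measure set (measurableTypeR R) -> \bar R} :=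
  mscale (NngNum (normr_ge0 k)) (pushforward mu phi).
suff -> : mu A = psi measurable_affine A by [].
apply: lebesgue_measure_unique => // _ [[a b]] _ <- /=.
rewrite /psi /mscale/= /pushforward lebesgue_measure_itv/=.
have [kgt|klt|k0'] := ltgtP 0 k; last by move: k0; rewrite -k0' eqxx.
- rewrite (_ : phi @^-1` _ = `](a - h) / k, (b - h) / k]%classic).
    rewrite lebesgue_measure_itv/= !lte_fin ltr_pM2r ?invr_gt0// ltrD2r.
    case: ifPn => ab; last by rewrite mule0.
    by rewrite -EFinB -EFinM -mulrBl gtr0_norm//; congr EFin; field.
  apply/seteqP; split => t /=; rewrite !in_itv/= /phi.
    by rewrite ltr_pdivrMr// ler_pdivlMr// => /andP[? ?]; apply/andP; split; lra.
  by rewrite ltr_pdivrMr// ler_pdivlMr// => /andP[? ?]; apply/andP; split; lra.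
- rewrite (_ : phi @^-1` _ = `[(b - h) / k, (a - h) / k[%classic).
    rewrite lebesgue_measure_itv/= !lte_fin ltr_nM2r ?invr_lt0// ltrD2r.
    case: ifPn => ab; last by rewrite mule0.
    by rewrite -EFinB -EFinM -mulrBl ltr0_norm//; congr EFin; field.
  apply/seteqP; split => t /=; rewrite !in_itv/= /phi.
    by rewrite ler_ndivrMr// ltr_ndivlMr// => /andP[? ?]; apply/andP; split; lra.
  by rewrite ler_ndivrMr// ltr_ndivlMr// => /andP[? ?]; apply/andP; split; lra.
Qed.

Lemma ge0_integral_affine (D : set (measurableTypeR R))
    (f : measurableTypeR R -> \bar R) :
  measurable D -> measurable_fun D f -> (forall x, D x -> 0 <= f x)%E ->
  (\int[mu]_(x in D) f x = `|k|%:E * \int[mu]_(x in phi @^-1` D) f (phi x))%E.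
Proof.
move=> mD mf f0.
pose psi : {measure set (measurableTypeR R) -> \bar R} :=
  mscale (NngNum (normr_ge0 k)) (pushforward mu phi).
rewrite (@eq_measure_integral _ _ R D (psi measurable_affine)); last first.
  by move=> A mA _; exact/esym/lebesgue_measure_affine.
rewrite ge0_integral_mscale//=; congr (_ * _)%E.
rewrite ge0_integral_pushforward//; first exact: measurable_affine.
by move=> x /set_mem; exact: f0.
Qed.

Lemma integrable_affine (D : set (measurableTypeR R))
    (f : measurableTypeR R -> R) : measurable D ->
  mu.-integrable D (EFin \o f) ->
  mu.-integrable (phi @^-1` D) (EFin \o (f \o phi)).
Proof.
move=> mD /integrableP[mf foo]; apply/integrableP; split.
  by apply: (measurable_comp mD) mf _; [move=> _ [x Dx <-]|
    apply: measurable_funTS; exact: measurable_affine].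
move: foo; rewrite ge0_integral_affine//; last exact: measurableT_comp.
apply: contraTT; rewrite -!leNgt !leye_eq => /eqP /= ->.
by rewrite gt0_muley// lte_fin normr_gt0.
Qed.

Lemma Rintegral_affine (D : set (measurableTypeR R))
    (f : measurableTypeR R -> R) : measurable D ->
  mu.-integrable D (EFin \o f) ->
  \int[mu]_(x in D) f x = `|k| * \int[mu]_(x in phi @^-1` D) f (phi x).
Proof.
move=> mD fi; have fi' := integrable_affine mD fi.
have mpD : measurable (phi @^-1` D).
  by rewrite -[X in measurable X]setTI; exact: measurable_affine.
have [mf _] := integrableP _ _ _ fi.
have ep := @ge0_integral_affine D (EFin \o f)^\+%E mD
  (measurable_funepos mf) (fun x _ => funepos_ge0 _ x).
have en := @ge0_integral_affine D (EFin \o f)^\-%E mD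
  (measurable_funeneg mf) (fun x _ => funeneg_ge0 _ x).
have pf := integrable_pos_fin_num mpD fi'.
have nf := integrable_neg_fin_num mpD fi'.
rewrite /Rintegral [in LHS]integralE [in RHS]integralE.
transitivity (fine (`|k|%:E * (\int[mu]_(x in phi @^-1` D)
    ((EFin \o (f \o phi))^\+ x) - \int[mu]_(x in phi @^-1` D)
    ((EFin \o (f \o phi))^\- x)))%E).
  congr fine; rewrite muleBr ?fin_num_adde_defl ?fin_numN//; congr (_ - _)%E.
  - by apply: (etrans ep); congr (_ * _)%E; apply: eq_integral => x _;
    rewrite !funeposE.
  - by apply: (etrans en); congr (_ * _)%E; apply: eq_integral => x _;
    rewrite !funenegE.
by rewrite fineM// fin_numB pf nf.
Qed.

End Affine.

(** * Square integrable functions *)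

Section SquareIntegrable.
Context {R : realType}.
Local Notation mu := (@lebesgue_measure R).
Implicit Types (D : set (measurableTypeR R)) (f g : R -> R).

(** Measurability of [f] is a separate clause because it does not follow from measurability of the
    square. *)
Definition sqint D f :=
  measurable_fun D f /\ mu.-integrable D (EFin \o (fun t => f t ^+ 2)).

Lemma sqint_integrableM D f g : measurable D ->
  sqint D f -> sqint D g -> mu.-integrable D (EFin \o (fun t => f t * g t)).
Proof.
move=> mD [mf f2] [mg g2].
apply: (le_integrable mD _ _ (integrableD mD f2 g2)) => /=.
  by apply/measurable_EFinP; exact: measurable_funM.
move=> t _ /=; rewrite lee_fin [leRHS]ger0_norm ?addr_ge0 ?sqr_ge0//.
rewrite ler_norml; apply/andP; split.
  by have := sqr_ge0 (f t + g t); have := sqr_ge0 (f t); have := sqr_ge0 (g t); nra.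
by have := sqr_ge0 (f t - g t); have := sqr_ge0 (f t); have := sqr_ge0 (g t); nra.
Qed.

Lemma sqintD D f g : measurable D -> sqint D f -> sqint D g ->
  sqint D (fun t => f t + g t).
Proof.
move=> mD sf sg; have [mf f2] := sf; have [mg g2] := sg.
split; first exact: measurable_funD.
rewrite (_ : EFin \o _ = (fun t => (f t ^+ 2)%:E + ((f t * g t)%:E +
  (f t * g t)%:E + (g t ^+ 2)%:E))%E).
  apply: integrableD => //; apply: integrableD => //.
  by apply: integrableD => //; exact: sqint_integrableM.
by apply/funext => t /=; rewrite -!EFinD; congr EFin; ring.
Qed.

Lemma sqintZ D f (k : R) : measurable D -> sqint D f ->
  sqint D (fun t => k * f t).
Proof.
move=> mD [mf f2]; split; first exact: measurable_funM.
rewrite (_ : EFin \o _ = (fun t => (k ^+ 2)%:E * (f t ^+ 2)%:E)%E).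
  exact: integrableZl.
by apply/funext => t /=; rewrite -EFinM exprMn.
Qed.

Lemma sqintB D f g : measurable D -> sqint D f -> sqint D g ->
  sqint D (fun t => f t - g t).
Proof.
move=> mD sf sg; rewrite (_ : (fun _ => _) = fun t => f t + (-1) * g t).
  by apply: sqintD => //; exact: sqintZ.
by apply/funext => t; rewrite mulN1r.
Qed.

Lemma eq_sqint D f g : measurable D -> {in D, f =1 g} -> sqint D f -> sqint D g.
Proof.
move=> mD fg [mf f2]; split; first exact: eq_measurable_fun mf.
by apply: eq_integrable f2 => // x xD /=; rewrite fg.
Qed.

Lemma sqintS D E f : measurable D -> measurable E -> E `<=` D ->
  sqint D f -> sqint E f.
Proof.
move=> mD mE ED [mf f2]; split; first exact: measurable_funS mf.
exact: integrableS f2.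
Qed.

Lemma sqint_bounded D f (M : R) : measurable D -> (mu D < +oo)%E ->
  measurable_fun D f -> (forall t, D t -> `|f t| <= M) -> sqint D f.
Proof.
move=> mD Doo mf fM; split => //.
apply: measurable_bounded_integrable => //; first exact: measurable_funX.
exists (M ^+ 2); split; first exact: num_real.
move=> x Mx t Dt /=; rewrite normrX; apply/ltW/(le_lt_trans _ Mx).
by rewrite lerXn2r ?nnegrE// ?fM// (le_trans _ (fM _ Dt)).
Qed.

Lemma sqint_continuous (a b : R) f : {within `[a, b], continuous f} ->
  sqint `[a, b] f.
Proof.
move=> cf; have mf : measurable_fun `[a, b] f.
  exact: subspace_continuous_measurable_fun.
have [M [_ fM]] := compact_bounded (continuous_compact cf (@segment_compact _ a b)).
apply: (@sqint_bounded _ _ (M + 1)) => //.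
  by rewrite lebesgue_measure_itv/=; case: ifP; rewrite ltry.
by move=> t abt; apply: (fM (M + 1)); [rewrite ltrDl|exists t].
Qed.

Lemma sqint_cst (a b k : R) : sqint `[a, b] (fun=> k).
Proof. by apply: sqint_continuous => x; exact: cst_continuous. Qed.

Lemma sqint_integrable (a b : R) f : sqint `[a, b] f ->
  mu.-integrable `[a, b] (EFin \o f).
Proof.
move=> sf; have := sqint_integrableM (measurable_itv _) sf (sqint_cst a b 1).
by rewrite (_ : EFin \o _ = EFin \o f)//; apply/funext => t /=; rewrite mulr1.
Qed.

Lemma sqint_integrable_sqr D f : sqint D f ->
  mu.-integrable D (EFin \o (fun t => f t ^+ 2)).
Proof. by case. Qed.

Lemma integrable_itv_split (a m b : R) f : a <= m <= b ->
  mu.-integrable `[a, m] (EFin \o f) -> mu.-integrable `[m, b] (EFin \o f) ->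
  mu.-integrable `[a, b] (EFin \o f).
Proof.
move=> /andP[am mb] i1 i2.
have abE : `[a, b]%classic = `[a, m] `|` `]m, b].
  by rewrite -itv_bndbnd_setU// bnd_simp.
have {}i2 : mu.-integrable `]m, b] (EFin \o f).
  by apply: integrableS i2 => //; apply: subset_itvr; rewrite bnd_simp.
have [m1 oo1] := integrableP _ _ _ i1; have [m2 oo2] := integrableP _ _ _ i2.
have mU : measurable_fun (`[a, m] `|` `]m, b]) (EFin \o f).
  exact/measurable_funU.
rewrite abE; apply/integrableP; split=> //.
rewrite ge0_integral_setU//; first by rewrite lte_add_pinfty.
  exact: measurableT_comp.
apply/disj_setPS => y [/=]; rewrite 2!in_itv/= => /andP[_ yx] /andP[].
by rewrite ltNge yx.
Qed.

Lemma Rintegral_itv_split (a m b : R) f : a <= m <= b ->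
  mu.-integrable `[a, b] (EFin \o f) ->
  \int[mu]_(t in `[a, b]) f t =
  \int[mu]_(t in `[a, m]) f t + \int[mu]_(t in `[m, b]) f t.
Proof.
move=> /andP[am mb] fi.
rewrite -(@Rintegral_itv_obnd_cbnd _ m); last first.
  apply: integrableS fi => //; apply: subset_itv; rewrite ?bnd_simp//.
by rewrite -(Rintegral_itvB fi) ?bnd_simp// addrC subrK.
Qed.

Lemma sqint_itv_split (a m b : R) f : a <= m <= b ->
  sqint `[a, m] f -> sqint `[m, b] f -> sqint `[a, b] f.
Proof.
move=> amb s1 s2; split; last first.
  by apply: (integrable_itv_split amb); exact: sqint_integrable_sqr.
have := integrable_itv_split amb (sqint_integrable s1) (sqint_integrable s2).
by move=> /integrableP[/measurable_EFinP].
Qed.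

Lemma integrable_itvS (a b c d : R) f : a <= c -> d <= b ->
  mu.-integrable `[a, b] (EFin \o f) -> mu.-integrable `[c, d] (EFin \o f).
Proof.
by move=> ac db; apply: integrableS => //; apply: subset_itv; rewrite bnd_simp.
Qed.

Lemma sqint_itvS (a b c d : R) f : a <= c -> d <= b ->
  sqint `[a, b] f -> sqint `[c, d] f.
Proof.
by move=> ac db; apply: sqintS => //; apply: subset_itv; rewrite bnd_simp.
Qed.

Lemma preimage_affine_itv (k h c d : R) : 0 < k ->
  (fun t => k * t + h) @^-1` `[c, d] = `[(c - h) / k, (d - h) / k]%classic.
Proof.
move=> k0; apply/seteqP; split => t /=; rewrite !in_itv/= ler_pdivrMr// ler_pdivlMr//.
  by move=> /andP[? ?]; apply/andP; split; lra.
by move=> /andP[? ?]; apply/andP; split; lra.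
Qed.

Lemma preimage_opp_itv (h c d : R) :
  (fun t => (-1) * t + h) @^-1` `[c, d] = `[h - d, h - c]%classic.
Proof.
apply/seteqP; split => t /=; rewrite !in_itv/= => /andP[? ?]; apply/andP; split; lra.
Qed.

Lemma sqint_affine (k h : R) D f : k != 0 -> measurable D -> sqint D f ->
  sqint ((fun t => k * t + h) @^-1` D) (fun t => f (k * t + h)).
Proof.
move=> k0 mD [mf f2]; split; last exact: (@integrable_affine R k h k0 D (fun t => f t ^+ 2) mD f2).
apply: (measurable_comp mD) mf _; first by move=> _ [x Dx <-].
apply: measurable_funTS; exact: measurable_affine.
Qed.

End SquareIntegrable.

(** * Absolute continuity and total variation *)

Section IntervalFamilies.
Context {R : realType}.
Implicit Types (a b : R) (p q : R * R) (s : seq (R * R)) (f : R -> R).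

(* An interval [[l, r]] is encoded as the pair [(r, l)], as in [variation_zip]. *)
Definition nonoverlap p q := (p.1 <= q.2) || (q.1 <= p.2).

Definition subitv a b p := [&& a <= p.2, p.2 <= p.1 & p.1 <= b].

Definition itv_family a b s := all (subitv a b) s && pairwise nonoverlap s.

(** Scalar counterpart of [abs_cont_on], over lists of intervals. The last inequality is not strict,
    so that it passes to suprema over partitions with the same [eps] and [delta]. *)
Definition ac a b f := forall eps, 0 < eps -> exists2 delta, 0 < delta &
  forall s, itv_family a b s -> \sum_(p <- s) (p.1 - p.2) < delta ->
    \sum_(p <- s) `|f p.1 - f p.2| <= eps.

Lemma nonoverlapC p q : nonoverlap p q = nonoverlap q p.
Proof. by rewrite /nonoverlap orbC. Qed.

Lemma nonoverlap_sub p q p' : subitv p.2 p.1 p' ->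
  nonoverlap p q -> nonoverlap p' q.
Proof.
rewrite /subitv /nonoverlap => /and3P[h1 h2 h3] /orP[h|h]; apply/orP; [left|right]; lra.
Qed.

Lemma path_itv_family a (l : seq R) : path <%O a l ->
  itv_family a (last a l) (zip l (a :: l)) /\
  \sum_(p <- zip l (a :: l)) (p.1 - p.2) = last a l - a.
Proof.
elim: l a => [|c l ih] a /=; first by rewrite big_nil subrr.
move=> /andP[ac_ pl]; have [/andP[al pw] sm] := ih _ pl.
have cl : c <= last c l.
  elim: l c {ac_ ih al pw sm} pl => //= d l ih c /andP[cd pl].
  by apply: le_trans (ih _ pl); exact: ltW.
split; last by rewrite big_cons sm /=; ring.
apply/andP; split => /=.
  rewrite /subitv/= lexx (ltW ac_) cl/=.
  by apply: sub_all al => p; rewrite /subitv => /and3P[? -> ->];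
    rewrite !andbT; lra.
rewrite pw andbT; apply: sub_all al => p /and3P[? ? ?].
by rewrite /nonoverlap/=; apply/orP; left.
Qed.

(** The intervals of [s1] are treated one at a time. A partition of the head [p] is moved into [s2],
    which keeps the family nonoverlapping and its total length unchanged, so the induction
    hypothesis applies; the supremum over partitions then yields the total variation on [p]. *)
Lemma total_variation_family a b f eps delta :
  (forall s, itv_family a b s -> \sum_(p <- s) (p.1 - p.2) < delta ->
    \sum_(p <- s) `|f p.1 - f p.2| <= eps) ->
  forall s1 s2, itv_family a b (s1 ++ s2) ->
  \sum_(p <- s1 ++ s2) (p.1 - p.2) < delta ->
  (\sum_(p <- s1) total_variation p.2 p.1 f +
    (\sum_(p <- s2) `|f p.1 - f p.2|)%:E <= eps%:E)%E.
Proof.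
move=> H; elim=> [|p s1 ih] s2 fam len; first by rewrite big_nil add0e lee_fin H.
set X := (\sum_(q <- s1) total_variation q.2 q.1 f)%E.
set Y := \sum_(q <- s2) _.
have X0 : (0 <= X)%E.
  rewrite /X big_seq; apply: sume_ge0 => q qs; apply: total_variation_ge0.
  move: (fam) => /andP[/allP fa _].
  suff /and3P[] : subitv a b q by [].
  by apply: fa; rewrite inE mem_cat qs orbT.
have refine (l : seq R) : itv_partition p.2 p.1 l ->
    (X + (Y + variation p.2 p.1 f l)%:E <= eps%:E)%E.
  move=> pl; have [pth /eqP lst] := pl.
  have [/andP[al pw] sm] := path_itv_family pth.
  rewrite lst in al sm.
  rewrite variation_zip// -big_cat /=; apply: ih.
    move: fam; rewrite /itv_family cat_cons /= !all_cat !pairwise_cat.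
    move=> /andP[/andP[psub /andP[al1 al2]]].
    move=> /andP[/andP[pn1 pn2] /and3P[n12 pw1 pw2]].
    rewrite al1 al2 /= pw1 pw2 pw/= !andbT.
    apply/and3P; split.
    - apply: sub_all al => q; move: psub; rewrite /subitv.
      by move=> /and3P[? ? ?] /and3P[? ? ?]; apply/and3P; split; lra.
    - rewrite allrel_catr n12/=; apply/allrelP => u v us vs.
      rewrite nonoverlapC; apply: (@nonoverlap_sub p); first exact: (allP al).
      exact: (allP pn1).
    - apply/allrelP => u v us vs.
      rewrite nonoverlapC; apply: (@nonoverlap_sub p); first exact: (allP al).
      exact: (allP pn2).
  by move: len; rewrite /= big_cons !big_cat/= sm; lra.
(* [X] has to be finite before it can be moved across the inequality; a single partition of [p]
   already bounds it by [eps]. *)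
have Xfin : X \is a fin_num.
  have [l pl] : exists l, itv_partition p.2 p.1 l.
    have : p.2 <= p.1 by case/andP: fam => /= /andP[/and3P[]].
    rewrite le_eqVlt => /predU1P[->|lt]; first by exists [::]; split => //=.
    by exists [:: p.1]; exact: itv_partition1.
  rewrite ge0_fin_numE//; apply: (@le_lt_trans _ _ eps%:E); last exact: ltry.
  apply: le_trans (refine l pl); rewrite leeDl// lee_fin addr_ge0//.
    by apply: sumr_ge0 => *.
  by apply: sumr_ge0 => *.
rewrite big_cons; apply: (@le_trans _ _
  (total_variation p.2 p.1 f + (X + Y%:E))%E).
  by rewrite addeA.
rewrite -leeBrDr; last by rewrite fin_numD Xfin.
apply: ge_ereal_sup => _ [_ [l pl <-] <-].
rewrite leeBrDr ?fin_numD ?Xfin//; apply: le_trans (refine l pl).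
by rewrite EFinD [leRHS]addeA [leRHS]addeC.
Qed.

Lemma total_variation_itv_family a b f eps delta :
  (forall s, itv_family a b s -> \sum_(p <- s) (p.1 - p.2) < delta ->
    \sum_(p <- s) `|f p.1 - f p.2| <= eps) ->
  forall s, itv_family a b s -> \sum_(p <- s) (p.1 - p.2) < delta ->
  (\sum_(p <- s) total_variation p.2 p.1 f <= eps%:E)%E.
Proof.
move=> H s fam len.
have := @total_variation_family _ _ _ _ _ H s [::].
by rewrite cats0 big_nil adde0; apply.
Qed.

(** On an interval shorter than the [delta] of [eps = 1] the total variation is at most 1, and
    finitely many steps of length [delta / 2] cover [[a, b]]. *)
Lemma ac_bounded_variation a b f : a <= b -> ac a b f ->
  bounded_variation a b f.
Proof.
move=> ab /(_ _ ltr01)[delta d0 H].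
apply/bounded_variationP => //.
have step c d : a <= c -> c <= d -> d <= b -> d - c < delta ->
    total_variation c d f \is a fin_num.
  move=> ac_ cd db dc; rewrite ge0_fin_numE ?total_variation_ge0//.
  apply: le_lt_trans (ltry 1).
  have := @total_variation_itv_family _ _ _ _ _ H [:: (d, c)].
  by rewrite !big_seq1/=; apply => //; rewrite /itv_family/= /subitv/= ac_ cd db.
have main (k : nat) : forall c, a <= c -> c <= b -> c - a <= k%:R * (delta / 2) ->
    total_variation a c f \is a fin_num.
  elim: k => [|k ih] c ac_ cb ck.
    have -> : c = a by apply/eqP; rewrite eq_le ac_ andbT; lra.
    by rewrite total_variationxx.
  pose m := Num.max a (c - delta / 2).
  have am : a <= m by rewrite le_max lexx.
  have mc : m <= c by rewrite ge_max ac_/=; lra.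
  have cm : c - m < delta.
    suff : c - delta / 2 <= m by lra.
    by rewrite le_max lexx orbT.
  rewrite (total_variationD _ am mc) fin_numD (step m c)// andbT; apply: ih => //.
    exact: le_trans cb.
  rewrite -natr1 in ck; rewrite lerBlDr ge_max; apply/andP; split; last lra.
  by rewrite lerDr mulr_ge0// divr_ge0// ltW.
have hk := ltW (truncnS_gt ((b - a) / (delta / 2))).
apply: (main (Num.truncn ((b - a) / (delta / 2))).+1) => //.
by rewrite -ler_pdivrMr ?divr_gt0.
Qed.

Definition itv_familyR s := all (fun p => p.2 <= p.1) s && pairwise nonoverlap s.

(** Stieltjes measures are built from functions on the whole line; [clamp] extends a function from
    [[a, b]] so that [ac] becomes [acR]. *)
Definition acR f := forall eps, 0 < eps -> exists2 delta, 0 < delta &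
  forall s, itv_familyR s -> \sum_(p <- s) (p.1 - p.2) < delta ->
    \sum_(p <- s) `|f p.1 - f p.2| <= eps.

Lemma acRB f g : acR f -> acR g -> acR (fun t => f t - g t).
Proof.
move=> acf acg e e0; have e20 : 0 < e / 2 by lra.
have [df df0 Hf] := acf _ e20; have [dg dg0 Hg] := acg _ e20.
exists (Num.min df dg); first by rewrite lt_min df0.
move=> s fs; rewrite lt_min => /andP[lf lg].
have := lerD (Hf s fs lf) (Hg s fs lg); rewrite -splitr; apply: le_trans.
rewrite -big_split/=; apply: ler_sum => p _.
rewrite (_ : _ - _ - _ = (f p.1 - f p.2) - (g p.1 - g p.2)); last ring.
exact: ler_normB.
Qed.

Definition clamp a b (t : R) := Num.max a (Num.min t b).

Lemma clampP a b (t : R) : a <= b -> a <= clamp a b t <= b.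
Proof. by move=> ab; rewrite /clamp le_max lexx ge_max ab ge_min lexx orbT. Qed.

Lemma clamp_id a b (t : R) : a <= t <= b -> clamp a b t = t.
Proof. by move=> /andP[at_ tb]; rewrite /clamp min_l// max_r. Qed.

Lemma clamp_homo a b (s t : R) : s <= t -> clamp a b s <= clamp a b t.
Proof. by move=> st; rewrite /clamp le_max2// le_min2. Qed.

Lemma clamp_contract a b (s t : R) : s <= t -> clamp a b t - clamp a b s <= t - s.
Proof.
move=> st; rewrite /clamp.
by have [tb|tb] := leP t b; have [sb|sb] := leP s b;
  repeat (match goal with |- context [Order.max ?x ?y] =>
    case: (leP x y) => ? end); lra.
Qed.

Definition clamp_pair a b p := (clamp a b p.1, clamp a b p.2).

Lemma clamp_family a b s : a <= b -> itv_familyR s ->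
  itv_family a b [seq clamp_pair a b p | p <- s] /\
  \sum_(p <- [seq clamp_pair a b p | p <- s]) (p.1 - p.2) <=
  \sum_(p <- s) (p.1 - p.2).
Proof.
move=> ab /andP[wf pw]; split; last first.
  rewrite big_map big_seq [leRHS]big_seq; apply: ler_sum => p ps.
  by apply: clamp_contract; exact: (allP wf).
apply/andP; split.
  rewrite all_map; apply: sub_all wf => p p21 /=.
  rewrite /subitv/= clamp_homo//.
  by have /andP[-> _] := clampP p.2 ab; have /andP[_ ->] := clampP p.1 ab.
rewrite pairwise_map; apply: sub_pairwise pw => p q /=.
by rewrite /nonoverlap/= => /orP[h|h]; apply/orP; [left|right]; exact: clamp_homo.
Qed.

Lemma acR_clamp a b f : a <= b -> ac a b f -> acR (f \o clamp a b).
Proof.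
move=> ab acf e e0; have [d d0 H] := acf _ e0.
exists d => // s fs len; have [fam le] := clamp_family ab fs.
by have := H _ fam (le_lt_trans le len); rewrite big_map.
Qed.

Definition tv a b f (t : R) := fine (total_variation a (clamp a b t) f).

Lemma tvE a b f (s t : R) : a <= b -> ac a b f -> s <= t ->
  (tv a b f t - tv a b f s)%:E =
  total_variation (clamp a b s) (clamp a b t) f.
Proof.
move=> ab acf st; have bv := ac_bounded_variation ab acf.
have /andP[as_ sb] := clampP s ab; have /andP[at_ tb] := clampP t ab.
have fin c d : a <= c -> c <= d -> d <= b -> total_variation c d f \is a fin_num.
  move=> ac_ cd db; apply/bounded_variationP => //.
  by apply: (bounded_variationl cd db); exact: (bounded_variationr ac_ (le_trans cd db)).
have cst := clamp_homo a b st.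
rewrite EFinB /tv !fineK ?fin//.
rewrite (total_variationD _ as_ cst) addeAC subee ?fin// add0e//.
Qed.

Lemma tv_homo a b f : a <= b -> ac a b f -> {homo tv a b f : s t / s <= t}.
Proof.
move=> ab acf s t st; rewrite -subr_ge0 -lee_fin tvE//.
by apply: total_variation_ge0; exact: clamp_homo.
Qed.

Lemma tv_ge a b f (s t : R) : a <= b -> ac a b f -> s <= t ->
  `|f (clamp a b t) - f (clamp a b s)| <= tv a b f t - tv a b f s.
Proof.
move=> ab acf st; rewrite -lee_fin tvE//.
by apply: total_variation_ge; exact: clamp_homo.
Qed.

Lemma acR_tv a b f : a <= b -> ac a b f -> acR (tv a b f).
Proof.
move=> ab acf e e0; have [d d0 H] := acf _ e0.
exists d => // s fs len; have [fam le] := clamp_family ab fs.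
have := total_variation_itv_family H fam (le_lt_trans le len).
rewrite big_map => bnd; rewrite -lee_fin; apply: le_trans bnd.
rewrite le_eqVlt; apply/orP; left; apply/eqP.
move/andP: fs => [wf _]; rewrite -sumEFin big_seq [RHS]big_seq.
apply: eq_bigr => p ps; have p21 := allP wf _ ps.
by rewrite ger0_norm ?tvE// subr_ge0 tv_homo.
Qed.

End IntervalFamilies.

(** * Densities of absolutely continuous functions *)

Lemma acR_cvg {R : realType} (H : R -> R) : acR H -> continuous H.
Proof.
move=> acH x; apply/(@cvgrPdist_le _ R^o) => e e0.
have [d d0 Hd] := acH _ e0.
exists d => //= t; rewrite /= => xt.
have [le|/ltW le] := leP x t.
  have := Hd [:: (t, x)]; rewrite /itv_familyR !big_seq1/= le => /(_ isT).
  rewrite distrC => ->//; apply: le_lt_trans xt; rewrite distrC; exact: ler_norm.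
have := Hd [:: (x, t)]; rewrite /itv_familyR !big_seq1/= le => /(_ isT); apply.
by apply: le_lt_trans xt; exact: ler_norm.
Qed.

Section StieltjesDensity.
Context {R : realType}.
Variable H : R -> R.
Hypothesis ndH : {homo H : s t / s <= t}.
Hypothesis acH : acR H.
Local Notation mu := (@lebesgue_measure R).

Let rcH : right_continuous H.
Proof. exact/right_continuousW/acR_cvg. Qed.

HB.instance Definition _ := isCumulative.Build R _ R H ndH rcH.

Let nu : {measure set (measurableTypeR R) -> \bar R} :=
  lebesgue_stieltjes_measure H.

Let nu_oc (s t : R) : s <= t -> nu `]s, t]%classic = (H t - H s)%:E.
Proof.
move=> st; rewrite /nu /= /lebesgue_stieltjes_measure /measure_extension/=.
by rewrite measurable_mu_extE/= ?wlength_itv_bnd//; exact: is_ocitv.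
Qed.

(** Openness excludes closed endpoints, finite measure excludes infinite ones. *)
Let open_itvE (I : set R) : open I -> is_interval I -> I !=set0 ->
  (mu I < +oo)%E -> exists l r, l < r /\ I = `]l, r[%classic.
Proof.
move=> oI iI I0 Ioo.
have [i IE] : exists i : interval R, I = [set` i] by exists (Rhull I); exact/is_intervalP.
subst I; move: i oI Ioo I0 {iI} => [x y] /= oI Ioo [z].
move: x y oI Ioo => x y.
case: x => [bx l|bx]; case: y => [by_ r|by_] /= oI; rewrite lebesgue_measure_itv/= => Ioo zI.
- have lr : l < r.
    rewrite lt_neqAle; apply/andP; split.
      apply/eqP => lr; subst r.
      have zl : z = l.
        by move: zI; rewrite in_itv/=; case: (bx); case: (by_) => /= /andP[]; lra.
      have [e /= e0 he] : nbhs z (fun u : R => [set` Interval (BSide bx l) (BSide by_ l)] u).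
        exact: open_nbhs_nbhs.
      have := he (z + e / 2); rewrite /= opprD addNKr normrN gtr0_norm ?divr_gt0//.
      move=> /(_ ltac:(lra)); rewrite in_itv/=; case: (bx); case: (by_) => /= /andP[]; lra.
    by move: zI; rewrite in_itv/=; case: (bx); case: (by_) => /= /andP[]; lra.
  exists l, r; split => //.
  have -> : bx = false.
    case: bx zI oI Ioo => // zI oI _.
    have [e /= e0 he] : nbhs l (fun u : R => [set` Interval (BLeft l) (BSide by_ r)] u).
      apply: open_nbhs_nbhs; split => //=; rewrite in_itv/= lexx/=.
      by case: (by_) => //=; exact: ltW.
    have := he (l - e / 2); rewrite /= opprB addrC subrK gtr0_norm ?divr_gt0//.
    by move=> /(_ ltac:(lra)); rewrite in_itv/= => /andP[]; lra.
  suff -> : by_ = true by [].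
  case: by_ zI oI Ioo => // zI oI _.
  have [e /= e0 he] : nbhs r (fun u : R => [set` Interval (BSide bx l) (BRight r)] u).
    apply: open_nbhs_nbhs; split => //=; rewrite in_itv/= lexx/= andbT.
    by case: (bx) => //=; exact: ltW.
  have := he (r + e / 2); rewrite /= opprD addNKr normrN gtr0_norm ?divr_gt0//.
  by move=> /(_ ltac:(lra)); rewrite in_itv/= => /andP[_]; lra.
- by case: by_ Ioo zI {oI}; rewrite ?in_itv/= ?andbF// ltry/= ?ltxx.
- by case: bx Ioo zI {oI}; rewrite ?in_itv//= ltNyr/= ?ltxx.
- by case: bx Ioo zI {oI}; case: by_; rewrite ?in_itv//= ?ltxx.
Qed.

Let mI (I : set R) : open I -> measurable (I : set (measurableTypeR R)).
Proof. exact: open_measurable. Qed.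

(** An open set is a countable disjoint union of open intervals. Finitely many of them form a family
    of total length below [delta], so [acH] bounds the sum of their Stieltjes measures; then the
    number of intervals goes to infinity. *)
Lemma stieltjes_open_small (eps : R) : 0 < eps -> exists2 delta : R, 0 < delta &
  forall U : set R, open U -> (mu U < delta%:E)%E ->
    (lebesgue_stieltjes_measure H U <= eps%:E)%E.
Proof.
move=> e0; have [delta d0 Hd] := acH e0; exists delta => // U oU Ud.
rewrite -/(nu U).
pose I := open_disjoint_itv oU.
have oI k : open (I k) by exact: open_disjoint_itv_open.
have iI k : is_interval (I k) by exact: open_disjoint_itv_is_interval.
have tI : trivIset setT I by exact: open_disjoint_itv_trivIset.
have UE : U = \bigcup_q I q by exact: open_disjoint_itv_bigcup.
have sumE (m : {measure set (measurableTypeR R) -> \bar R}) :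
    m U = (\sum_(k <oo) m (I k))%E.
  rewrite {1}UE measure_semi_bigcup//; first by move=> k; exact: mI.
  by rewrite -UE; exact: mI.
have partial n : (\sum_(0 <= k < n) mu (I k) <= mu U)%E.
  rewrite (sumE mu); apply: nneseries_lim_ge => k _ _; exact: measure_ge0.
have Ioo k : (mu (I k) < +oo)%E.
  apply: le_lt_trans (lt_trans Ud (ltry _)).
  apply: le_measure; rewrite ?inE; [exact: mI|exact: mI|].
  by rewrite UE; exact: bigcup_sup.
have pP k : exists p : R * R, I k !=set0 -> p.2 < p.1 /\ I k = `]p.2, p.1[%classic.
  have [ne|ne] := pselect (I k !=set0); last by exists (0, 0) => /ne.
  by have [l [r ?]] := open_itvE (oI k) (@iI k) ne (Ioo k); exists (r, l).
have [p {}pP] := choice pP.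
rewrite (sumE nu); apply: lime_le.
  by apply: is_cvg_nneseries => k _ _; exact: measure_ge0.
near=> n.
(* Empty components have no endpoints to put into a family; they are filtered out and contribute
   nothing to either sum. *)
pose K := [seq k <- iota 0 n | `[< I k !=set0 >]].
have Kne k : k \in K -> I k !=set0 by rewrite mem_filter => /andP[/asboolP].
have sumK (m : {measure set (measurableTypeR R) -> \bar R}) :
    (\sum_(0 <= k < n) m (I k) = \sum_(k <- K) m (I k))%E.
  rewrite /K big_filter /index_iota subn0 [RHS]big_mkcond/=.
  apply: eq_bigr => k _; case: ifPn => // /asboolPn/set0P/negP/negPn/eqP ->.
  by rewrite measure0.
have fam : itv_familyR [seq p k | k <- K].
  apply/andP; split.
    by rewrite all_map; apply/allP => k /Kne /pP[/ltW].
  rewrite pairwise_map.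
  have : pairwise [rel x y | x != y] K.
    by rewrite -uniq_pairwise filter_uniq// iota_uniq.
  apply: (@sub_in_pairwise _ [pred k | k \in K]); last by apply/allP.
  move=> i j /= /Kne /pP[li Ei] /Kne /pP[lj Ej] ij.
  rewrite /nonoverlap; apply: contrapT => /negP; rewrite negb_or -!ltNge.
  move=> /andP[h1 h2].
  have /trivIsetP/(_ i j Logic.I Logic.I ij) := tI.
  rewrite Ei Ej => /seteqP[+ _].
  pose u := Num.max (p i).2 (p j).2; pose v := Num.min (p i).1 (p j).1.
  have uv : u < v by rewrite lt_min !gt_max li lj h1 h2.
  move=> /(_ ((u + v) / 2)); apply.
  have u1 : (p i).2 <= u by rewrite le_max lexx.
  have u2 : (p j).2 <= u by rewrite le_max lexx orbT.
  have v1 : v <= (p i).1 by rewrite ge_min lexx.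
  have v2 : v <= (p j).1 by rewrite ge_min lexx orbT.
  by split; rewrite /= in_itv/=; apply/andP; split; lra.
have len : \sum_(q <- [seq p k | k <- K]) (q.1 - q.2) < delta.
  rewrite big_map -lte_fin; apply: le_lt_trans Ud; apply: le_trans (partial n).
  rewrite (sumK mu) -sumEFin big_seq [leRHS]big_seq; apply: lee_sum => k /Kne /pP[lk ->].
  have := lebesgue_measure_itv `](p k).2, (p k).1[.
  by rewrite /= lte_fin lk => e; apply: (@le_trans _ _ (mu `](p k).2, (p k).1[%classic));
    first by rewrite e.
have := Hd _ fam len; rewrite big_map -lee_fin; apply: le_trans.
rewrite (sumK nu) -sumEFin big_seq [leRHS]big_seq; apply: lee_sum => k /Kne /pP[lk ->].
apply: (@le_trans _ _ (nu `](p k).2, (p k).1]%classic)).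
  apply: le_measure; rewrite ?inE//; apply: subset_itvl; rewrite bnd_simp//.
by rewrite nu_oc ?lee_fin ?ler_norm// ltW.
Unshelve. all: by end_near. Qed.

Let D (a b : R) : set (measurableTypeR R) := `]a, b]%classic.

Let mD a b : measurable (D a b). Proof. exact: measurable_itv. Qed.

Let Doo a b : (lebesgue_stieltjes_measure H (D a b) < +oo)%E.
Proof.
have [ab|ba] := leP a b; first by have := nu_oc ab; rewrite /nu /= => ->; exact: ltry.
by rewrite /D set_itv_ge ?measure0 ?ltry// bnd_simp -leNgt ltW.
Qed.

(** By outer regularity a Lebesgue null set lies in open sets of arbitrarily small measure, which
    [stieltjes_open_small] makes small for the Stieltjes measure: this is domination. Restriction to
    []a, b]] makes the measure finite, as the Radon-Nikodym derivative of a charge requires. *)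
Lemma stieltjes_density (a b : R) : exists h : R -> R,
  mu.-integrable `]a, b] (EFin \o h) /\
  forall s t, a <= s -> s <= t -> t <= b ->
    H t - H s = \int[mu]_(x in `]s, t]) h x.
Proof.
pose rho : {finite_measure set (measurableTypeR R) -> \bar R} :=
  mfrestr (mD a b) (Doo a b).
have dom : rho `<< mu.
  apply/null_content_dominatesP => A mA A0.
  apply/eqP; rewrite eq_le measure_ge0 andbT; apply/lee_addgt0Pr => e e0.
  rewrite add0e.
  have [d d0 Hd] := stieltjes_open_small e0.
  have [|U [oU AU Ud]] := lebesgue_regularity_outer mA _ d0.
    by rewrite [X in (X < _)%E]A0.
  apply: (@le_trans _ _ (nu U)).
    rewrite /rho /= /mfrestr /mrestr; apply: le_measure; rewrite ?inE.
    - exact: measurableI.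
    - exact: mI.
    - by move=> x [/AU].
  apply: Hd => //; apply: le_lt_trans Ud.
  by rewrite -{1}(setDKU AU) measureU0//; apply: measurableD => //; exact: mI.
pose c := charge_of_finite_measure rho.
have fin x : Radon_Nikodym c mu x \is a fin_num by exact: Radon_Nikodym_fin_num.
have int := @Radon_Nikodym_integrable _ _ _ c mu dom.
have eqf : Radon_Nikodym c mu = EFin \o (fine \o Radon_Nikodym c mu).
  by apply/funext => x /=; rewrite fineK.
exists (fine \o Radon_Nikodym c mu); split.
  by rewrite -eqf; apply: integrableS int.
move=> s t as_ st tb; rewrite /Rintegral.
have := @Radon_Nikodym_integral _ _ _ c mu `]s, t]%classic dom (measurable_itv _).
move=> e; transitivity (fine (c `]s, t]%classic)); last first.
  by rewrite [c _]e; congr fine; apply: eq_integral => x _; rewrite /= fineK.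
rewrite /c /charge_of_finite_measure /rho /= /mfrestr /mrestr setIidl.
  by have := nu_oc st; rewrite /nu /= => ->.
by apply: subset_itv; rewrite bnd_simp.
Qed.

End StieltjesDensity.

Section AbsolutelyContinuousDensity.
Context {R : realType}.
Local Notation mu := (@lebesgue_measure R).

(** Jordan decomposition: [f] is the difference of [tv a b f] and [G], both nondecreasing and
    absolutely continuous, so the density is the difference of theirs. *)
Lemma ac_density (a b : R) (f : R -> R) : a <= b -> ac a b f ->
  exists h : R -> R, mu.-integrable `[a, b] (EFin \o h) /\
  forall s t, a <= s -> s <= t -> t <= b ->
    f t - f s = \int[mu]_(x in `[s, t]) h x.
Proof.
move=> ab acf.
have [h1 [i1 e1]] := stieltjes_density (tv_homo ab acf) (acR_tv ab acf) a b.
pose G t := tv a b f t - (f \o clamp a b) t.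
have ndG : {homo G : s t / s <= t}.
  move=> s t st; rewrite /G lerBlDr addrAC lerBrDr -lerBrDl.
  have := tv_ge ab acf st; rewrite /= => h.
  by have := ler_norm (f (clamp a b t) - f (clamp a b s)); lra.
have acG : acR G := acRB (acR_tv ab acf) (acR_clamp ab acf).
have [h2 [i2 e2]] := stieltjes_density ndG acG a b.
have close h : mu.-integrable `]a, b] (EFin \o h) ->
    mu.-integrable `[a, b] (EFin \o h).
  move=> hi; have [mh hoo] := integrableP _ _ _ hi.
  have m' : measurable_fun `[a, b] (EFin \o h).
    rewrite -(setU1itv false)//; apply/measurable_funU => //.
    by split => //; exact: measurable_fun_set1.
  apply/integrableP; split => //; rewrite -integral_itv_obnd_cbnd//.
  by apply: measurableT_comp => //; exact/measurable_EFinP.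
exists (fun t => h1 t - h2 t); split.
  rewrite (_ : EFin \o _ = (fun t => (EFin \o h1) t - (EFin \o h2) t)%E) //.
  by apply: integrableB => //; exact: close.
move=> s t as_ st tb.
have itvS h : mu.-integrable `]a, b] (EFin \o h) ->
    mu.-integrable `]s, t] (EFin \o h).
  by apply: integrableS => //; apply: subset_itv; rewrite bnd_simp.
rewrite -Rintegral_itv_obnd_cbnd; last first.
  rewrite (_ : EFin \o _ = (fun t => (EFin \o h1) t - (EFin \o h2) t)%E) //.
  by apply: integrableB => //; exact: itvS.
rewrite RintegralB//; [|exact: itvS|exact: itvS].
rewrite -e1// -e2// /G /= !clamp_id; last 2 first.
  by apply/andP; split; lra.
  by apply/andP; split; lra.
by ring.
Qed.

End AbsolutelyContinuousDensity.

Section Primitives.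
Context {R : realType}.
Local Notation mu := (@lebesgue_measure R).

(** Lebesgue differentiation is applied to [h] extended by zero; near an interior point, [F] and the
    primitive of this extension differ by the constant [F a]. *)
Lemma ae_derive_primitive (a b : R) (F h : R -> R) :
  mu.-integrable `[a, b] (EFin \o h) ->
  (forall s t, a <= s -> s <= t -> t <= b ->
    F t - F s = \int[mu]_(u in `[s, t]) h u) ->
  exists N : set (measurableTypeR R), [/\ measurable N, mu N = 0 &
    forall t, a < t < b -> ~ N t -> derivable F t 1 /\ derive1 F t = h t].
Proof.
move=> ih Fh.
pose f := h \_ `[a, b].
have intf : mu.-integrable setT (EFin \o f).
  by rewrite /f -restrict_EFin; apply/integrable_restrict => //=; rewrite ?(setIT, setTI).
have intfy y : mu.-integrable [set` Interval (BLeft a) (BRight y)] (EFin \o f).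
  by apply: integrableS intf.
have locf : locally_integrable [set: R] f.
  by have := integrable_locally measurableT intf; rewrite patch_setT.
have [N [mN N0 subN]] := FTC1 intfy locf.
exists N; split=> // t /andP[at_ tb] Nt.
have [dG G't] : derivable (fun x => \int[mu]_(u in [set` Interval (BLeft a) (BRight x)]) f u) t 1
    /\ derive1 (fun x => \int[mu]_(u in [set` Interval (BLeft a) (BRight x)]) f u) t = f t.
  apply: contrapT => hn; apply: Nt; apply: subN => /= ht; apply: hn.
  by apply: ht; rewrite lte_fin.
move: dG G't; set G := (fun x : R => _) => dG G't.
have FG : \forall u \near t, F a + G u = F u.
  near=> u.
  have au : a <= u by apply/ltW; near: u; exact: lt_nbhsr.
  have ub : u <= b by apply/ltW; near: u; exact: lt_nbhsl.
  rewrite (_ : F u = F a + (F u - F a)); last by ring.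
  rewrite (Fh a u)// /G; congr (_ + _); apply: eq_Rintegral => v.
  rewrite inE/= in_itv/= => /andP[av vu]; rewrite /f patchE mem_set//=.
  by rewrite in_itv/= av (le_trans vu).
have dFt : is_derive t 1 F (f t).
  apply: near_eq_is_derive FG _; rewrite -[f t]add0r.
  have dc : is_derive t (1 : R) (cst (F a)) 0 := is_derive_cst _ _ _.
  apply: (is_deriveD dc).
  by rewrite -G't derive1E; exact: derivableP.
split; first exact: ex_derive.
rewrite derive1E derive_val.
by rewrite /f patchE mem_set//= in_itv/= !ltW.
Unshelve. all: by end_near. Qed.

Lemma ae_derive_primitive_rV n (a b : R) (phi g : R -> 'rV[R]_n) :
  (forall i, mu.-integrable `[a, b] (EFin \o (fun t => g t 0 i)) /\
    forall s t, a <= s -> s <= t -> t <= b ->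
    phi t 0 i - phi s 0 i = \int[mu]_(u in `[s, t]) g u 0 i) ->
  exists N : set (measurableTypeR R), [/\ measurable N, mu N = 0 &
    forall t, a <= t <= b -> ~ N t -> derive1 phi t = g t].
Proof.
move=> H.
have HN i := ae_derive_primitive (H i).1 (H i).2.
have [N {}HN] := choice HN.
(* The endpoints join the null set: [phi] is unconstrained outside [[a, b]], so its two-sided
   derivative there is out of control. *)
pose M := \big[setU/set0]_(i < n) N i `|` ([set a] `|` [set b]).
have mN i : measurable (N i) by case: (HN i).
have [mB B0] : measurable (\big[setU/set0]_(i < n) N i : set (measurableTypeR R))
    /\ mu (\big[setU/set0]_(i < n) N i) = 0.
  apply: (big_ind (fun A : set (measurableTypeR R) => measurable A /\ mu A = 0)).
  - by split.
  - by move=> A B [mA A0] [mB B0]; split; [exact: measurableU|rewrite measureU0].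
  - by move=> i _; case: (HN i).
exists M; split.
- by apply: measurableU => //; apply: measurableU.
- rewrite /M measureU0//; first exact: measurableU.
  by rewrite measureU0//; exact: lebesgue_measure_set1.
- move=> t abt Mt.
  have tab : a < t < b.
    move: abt; rewrite !le_eqVlt => /andP[/predU1P[e|->] /predU1P[e'|->]]//;
    exfalso; apply: Mt; right; by [left|right].
  have D i : derivable (fun u => phi u 0 i) t 1 /\ derive1 (fun u => phi u 0 i) t = g t 0 i.
    have [_ _] := HN i; apply => // Nt; apply: Mt; left.
    by rewrite (bigD1 i)//; left.
  have dphi : derivable phi t 1.
    by apply/derivable_mxP => i j; rewrite ord1; exact: (D j).1.
  rewrite derive1E derive_mx//; apply/rowP => i; rewrite !mxE.
  by rewrite -derive1E (D i).2.
Qed.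

End Primitives.

(** * Paths with square integrable velocity *)

Section IntegralSum.
Context {R : realType}.
Local Notation mu := (@lebesgue_measure R).

Lemma integrable_Rsum (I : Type) (s : seq I) (D : set (measurableTypeR R))
    (f : I -> R -> R) : measurable D ->
  (forall i, mu.-integrable D (EFin \o f i)) ->
  mu.-integrable D (EFin \o (fun t => \sum_(i <- s) f i t)).
Proof.
move=> mD fi; rewrite (_ : EFin \o _ = fun t => (\sum_(i <- s) (f i t)%:E)%E).
  by apply: integrable_sum => // i _; exact: fi.
by apply/funext => t /=; rewrite sumEFin.
Qed.

Lemma Rintegral_sum (I : Type) (s : seq I) (D : set (measurableTypeR R))
    (f : I -> R -> R) : measurable D ->
  (forall i, mu.-integrable D (EFin \o f i)) ->
  \int[mu]_(t in D) (\sum_(i <- s) f i t) = \sum_(i <- s) \int[mu]_(t in D) f i t.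
Proof.
move=> mD fi; elim: s => [|i s ih].
  rewrite big_nil (@eq_Rintegral _ _ _ _ _ (fun=> 0)).
    by rewrite Rintegral_cst// mul0r.
  by move=> t _; rewrite big_nil.
rewrite big_cons -ih -RintegralD//; last exact: integrable_Rsum.
by apply: eq_Rintegral => t _; rewrite big_cons.
Qed.

End IntegralSum.

Section EuclideanNorm.
Context {R : realType} {n : nat}.
Implicit Types u v : 'rV[R]_n.

Lemma sqn_ge0 u : 0 <= sqn u.
Proof. by apply: sumr_ge0 => i _; rewrite -expr2 sqr_ge0. Qed.

Lemma sqr_coord_le_sqn u i : u 0 i ^+ 2 <= sqn u.
Proof.
rewrite /sqn /dotv (bigD1 i)//= -expr2 lerDl.
by apply: sumr_ge0 => j _; rewrite -expr2 sqr_ge0.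
Qed.

Lemma coord_le_enorm u i : `|u 0 i| <= enorm u.
Proof.
rewrite -sqrtr_sqr /enorm ler_sqrt ?sqn_ge0//; first exact: sqr_coord_le_sqn.
Qed.

Lemma enorm_le_sum u : enorm u <= \sum_i `|u 0 i|.
Proof.
set S := \sum_i _.
have S0 : 0 <= S by exact: sumr_ge0.
rewrite /enorm -[leRHS]ger0_norm// -sqrtr_sqr ler_sqrt ?sqr_ge0//.
rewrite expr2 {1}/S mulr_suml; apply: ler_sum => i _.
apply: (@le_trans _ _ (`|u 0 i| * `|u 0 i|)).
  by rewrite -normrM ler_norm.
by rewrite ler_wpM2l// /S (bigD1 i)//= lerDl sumr_ge0.
Qed.

Lemma sqr_enorm u : enorm u ^+ 2 = sqn u.
Proof. by rewrite sqr_sqrtr// sqn_ge0. Qed.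

Lemma enormC u v : enorm (u - v) = enorm (v - u).
Proof.
rewrite /enorm /dotv; congr Num.sqrt; apply: eq_bigr => i _.
by rewrite !mxE; ring.
Qed.

Lemma mx_norm_le_enorm u : `|u| <= enorm u.
Proof.
rewrite [leLHS]/Num.Def.normr/= mx_normrE; apply: bigmax_le; first exact: sqrtr_ge0.
by move=> [i j] _ /=; rewrite ord1; exact: coord_le_enorm.
Qed.

End EuclideanNorm.

Section Prim.
Context {R : realType} {n : nat}.
Local Notation mu := (@lebesgue_measure R).
Implicit Types phi g : R -> 'rV[R]_n.

(** The working form of a path: [g] is a chosen velocity with values at every time, so shift,
    reversal and gluing act on the pair without asking where [phi] is differentiable. *)
Definition prim (a b : R) (phi g : R -> 'rV[R]_n) := forall i : 'I_n,
  sqint `[a, b] (fun t => g t 0 i) /\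
  forall s t, a <= s -> s <= t -> t <= b ->
    phi t 0 i - phi s 0 i = \int[mu]_(u in `[s, t]) g u 0 i.

Lemma prim_derive1 a b phi g : prim a b phi g ->
  exists N : set (measurableTypeR R), [/\ measurable N, mu N = 0 &
    forall t, a <= t <= b -> ~ N t -> derive1 phi t = g t].
Proof.
move=> pg; apply: ae_derive_primitive_rV => i; have [sg ph] := pg i.
by split => //; exact: sqint_integrable.
Qed.

Lemma abs_cont_coord a b phi i : abs_cont_on a b phi ->
  ac a b (fun t => phi t 0 i).
Proof.
move=> acp e e0; have [d [d0 H]] := acp _ e0; exists d => // s /andP[al pw].
rewrite !(big_nth (0, 0)) !big_mkord => len.
have ok k : (k < size s)%N -> subitv a b (nth (0, 0) s k).
  by move=> ks; apply: (allP al); exact: mem_nth.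
apply: le_trans (ltW (H (size s) (fun k => (nth (0, 0) s k).2)
    (fun k => (nth (0, 0) s k).1) _ _ len)).
- by apply: ler_sum => k _; apply: le_trans (coord_le_enorm _ i); rewrite !mxE.
- by move=> k /ok /and3P[].
- move=> k m ks ms /eqP; rewrite neq_ltn => /orP[km|mk].
    have := (pairwiseP (0, 0) pw) k m ks ms km.
    by rewrite /nonoverlap => /orP.
  have := (pairwiseP (0, 0) pw) m k ms ks mk.
  by rewrite /nonoverlap => /orP[]; [right|left].
Qed.

(** The densities of the coordinates agree with [derive1 phi] almost everywhere, so the finite
    integral in [HT] makes each of them square integrable. *)
Lemma HT_prim T phi : 0 <= T -> HT T phi -> exists g, prim 0 T phi g.
Proof.
move=> T0 [acp Ioo].
have [h H] := choice (fun i => ac_density T0 (abs_cont_coord i acp)).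
pose g t : 'rV[R]_n := \row_i h i t.
have gE i : (fun t => g t 0 i) = h i by apply/funext => t; rewrite mxE.
have H' i : mu.-integrable `[0, T] (EFin \o (fun t => g t 0 i)) /\
    forall s t, 0 <= s -> s <= t -> t <= T ->
    phi t 0 i - phi s 0 i = \int[mu]_(u in `[s, t]) g u 0 i.
  have [ih ph] := H i; split; first by rewrite gE.
  by move=> s t ? ? ?; rewrite ph//; apply: eq_Rintegral => u _; rewrite mxE.
have [N [mN N0 NE]] := ae_derive_primitive_rV H'.
exists g => i; have [ih ph] := H' i; split => //; split.
  by have [/measurable_EFinP] := integrableP _ _ _ ih.
have mg j : measurable_fun `[0, T] (fun t => g t 0 j).
  by have [/measurable_EFinP] := integrableP _ _ _ (H' j).1.
apply/integrableP; split.
  by apply/measurable_EFinP; exact: (measurable_funX 2 (mg i)).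
apply: le_lt_trans Ioo.
rewrite (@integral_eq_off_null _ _ _ mu _ N (fun t => (sqn (derive1 phi t))%:E)
  (fun t => (sqn (g t))%:E) mN N0); last first.
  by move=> t; rewrite /= in_itv/= => tT nN; rewrite NE.
apply: ge0_le_integral => //.
- by apply: measurableT_comp => //; apply/measurable_EFinP; exact: (measurable_funX 2 (mg i)).
- apply/measurable_EFinP; apply: measurable_sum => j; exact: (measurable_funM (mg j) (mg j)).
- move=> t _ /=; rewrite ger0_norm ?sqr_ge0// lee_fin; exact: sqr_coord_le_sqn.
Qed.

(** Increments of [phi] are bounded by integrals of [F0], and the integral of an integrable function
    over a set is small once the set has small measure. *)
Lemma prim_abs_cont a b phi g : prim a b phi g -> abs_cont_on a b phi.
Proof.
move=> pg e e0.
pose F0 u := \sum_i `|g u 0 i|.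
have F00 u : 0 <= F0 u by apply: sumr_ge0.
have iF0 : mu.-integrable `[a, b] (EFin \o F0).
  rewrite (_ : EFin \o F0 = fun u => (\sum_i (`|g u 0 i|)%:E)%E); last first.
    by apply/funext => u; rewrite /= sumEFin.
  apply: integrable_sum => // i _; apply: integrable_norm.
  by have [/sqint_integrable] := pg i.
pose F := F0 \_ `[a, b].
have iF : mu.-integrable setT (EFin \o F).
  by rewrite /F -restrict_EFin; apply/integrable_restrict => //=; rewrite ?(setIT, setTI).
have [d [d0 Hd]] := integral_normr_continuous iF e0.
exists d; split => // N l r lr novl len.
(* Half-open intervals, so that two of them that touch are disjoint. *)
pose I k : set (measurableTypeR R) := `]l k, r k]%classic.
pose A : set (measurableTypeR R) := \big[setU/set0]_(k <- iota 0 N) I k.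
have tI : trivIset [set` iota 0 N] I.
  apply/trivIsetP => i j /=; rewrite !mem_iota !add0n => iN jN ij.
  rewrite /I; apply/seteqP; split => // u /= [].
  rewrite !in_itv/= => /andP[? ?] /andP[? ?].
  by exfalso; have [?|?] := novl i j iN jN (elimN eqP ij); lra.
have iotaE : iota 0 N = index_iota 0 N by rewrite /index_iota subn0.
have mI k : measurable (I k) by exact: measurable_itv.
have mA : measurable A by apply: bigsetU_measurable => k _; exact: measurable_itv.
have muA : mu A = (\sum_(k < N) (r k - l k))%:E.
  rewrite -[mu A]mul1e -(integral_cst mu mA 1%:E).
  rewrite ge0_integral_bigsetU ?iota_uniq//.
  rewrite iotaE big_mkord -sumEFin.
  apply: eq_bigr => k _; rewrite integral_cst// mul1e.
  have [_ [lk _]] := lr k (ltn_ord k).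
  have := lebesgue_measure_itv `]l k, r k]; rewrite /= lte_fin => ->.
  by case: ltgtP lk => // ->; rewrite subrr.
have Ad : (mu A < d%:E)%E by rewrite muA lte_fin.
have := Hd A mA Ad; apply: le_lt_trans.
rewrite -lee_fin.
have -> : (\int[mu]_(x in A) `|F x|)%:E = (\int[mu]_(x in A) (`|F x|)%:E)%E.
  rewrite /Rintegral fineK//; apply: integrable_fin_num => //.
  by apply: integrable_norm; exact: integrableS iF.
rewrite ge0_integral_bigsetU ?iota_uniq//; last first.
  apply: measurable_funTS; apply/measurable_EFinP; apply: measurableT_comp => //.
  by have [/measurable_EFinP] := integrableP _ _ _ iF.
rewrite iotaE big_mkord -sumEFin.
apply: lee_sum => k _.
have [al [lk rb]] := lr k (ltn_ord k).
have iFk : mu.-integrable (I k) (EFin \o F) by exact: integrableS iF.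
have iFk' : mu.-integrable `[l k, r k] (EFin \o F0) by exact: integrable_itvS iF0.
have -> : (\int[mu]_(x in I k) (`|F x|)%:E = (\int[mu]_(x in `[l k, r k]) F0 x)%:E)%E.
  rewrite -Rintegral_itv_obnd_cbnd; last first.
    by apply: integrableS iFk' => //; apply: subset_itv; rewrite bnd_simp.
  rewrite /Rintegral fineK; last first.
    apply: integrable_fin_num => //.
    by apply: integrableS iFk' => //; apply: subset_itv; rewrite bnd_simp.
  apply: eq_integral => u; rewrite inE /I /= in_itv/= => /andP[lu ur].
  rewrite /F patchE mem_set/=; last by rewrite in_itv/=; apply/andP; split; lra.
  by rewrite ger0_norm.
rewrite lee_fin; apply: le_trans (enorm_le_sum _) _.
have -> : \int[mu]_(x in `[l k, r k]) F0 x =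
    \sum_i \int[mu]_(x in `[l k, r k]) `|g x 0 i|.
  apply: Rintegral_sum => // i; apply: integrable_norm.
  by have [sg _] := pg i; exact: integrable_itvS (sqint_integrable sg).
apply: ler_sum => i _; rewrite !mxE; have [sg ph] := pg i.
rewrite ph//; apply: le_normr_Rintegral => //.
exact: integrable_itvS (sqint_integrable sg).
Qed.

Lemma prim_unif a b phi g : prim a b phi g -> forall e, 0 < e ->
  exists2 d, 0 < d & forall s t, a <= s <= b -> a <= t <= b -> `|t - s| < d ->
    enorm (phi t - phi s) < e.
Proof.
move=> pg e e0; have [d [d0 H]] := prim_abs_cont pg e0; exists d => // s t.
wlog st : s t / s <= t => [wl|/andP[as_ sb] /andP[at_ tb]].
  have [/wl//|/ltW ts] := leP s t => abs_ abt.
  by rewrite distrC enormC; exact: wl.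
rewrite ger0_norm ?subr_ge0// => tsd.
have := H 1 (fun=> s) (fun=> t); rewrite !big_ord1; apply => //.
by move=> [|k] [|m].
Qed.

Lemma prim_clamp_continuous a b phi g : a <= b -> prim a b phi g ->
  continuous (phi \o clamp a b).
Proof.
move=> ab pg x; apply/cvgrPdist_le => e e0.
have [d d0 H] := prim_unif pg e0; exists d => //= t xt.
apply: le_trans (mx_norm_le_enorm _) (ltW _); rewrite enormC.
apply: H; [exact: clampP|exact: clampP|]; apply: le_lt_trans xt.
have key s u : s <= u -> `|clamp a b u - clamp a b s| <= `|u - s|.
  move=> su; rewrite !ger0_norm ?subr_ge0 ?clamp_homo//; exact: clamp_contract.
have [le|/ltW le] := leP x t; first by rewrite [leRHS]distrC key.
by rewrite [leLHS]distrC key.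
Qed.

Lemma sqint_comp_prim a b phi g (h : 'rV[R]_n -> R) : a <= b ->
  prim a b phi g -> continuous h -> sqint `[a, b] (h \o phi).
Proof.
move=> ab pg ch; apply: (@eq_sqint _ _ (h \o (phi \o clamp a b))) => //.
  by move=> t; rewrite inE/= in_itv/= => tab; rewrite clamp_id.
apply: sqint_continuous; apply: continuous_subspaceT => x.
by apply: continuous_comp; [exact: (prim_clamp_continuous ab pg)|exact: ch].
Qed.

Lemma integrable_dotv (D : set (measurableTypeR R)) (u v : R -> 'rV[R]_n) :
  measurable D ->
  (forall i, sqint D (fun t => u t 0 i)) -> (forall i, sqint D (fun t => v t 0 i)) ->
  mu.-integrable D (EFin \o (fun t => dotv (u t) (v t))).
Proof.
by move=> mD su sv; apply: integrable_Rsum => // i; exact: sqint_integrableM.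
Qed.

End Prim.

(** * The chain rule along paths *)

Section Cousin.
Context {R : realType}.

(** In the spirit of Cousin's lemma: the supremum of the [t] with [P a t] must be [b], since local
    validity around that supremum would push it further. *)
Lemma interval_local_to_global (P : R -> R -> Prop) (a b : R) : a <= b ->
  (forall s m t, a <= s -> s <= m -> m <= t -> t <= b -> P s m -> P m t -> P s t) ->
  (forall x, a <= x <= b -> exists2 d, 0 < d & forall s t, a <= s -> s <= x ->
    x <= t -> t <= b -> x - d < s -> t < x + d -> P s t) ->
  P a b.
Proof.
move=> ab tr loc.
pose S := [set t | a <= t <= b /\ P a t].
have Sa : S a.
  split; first by rewrite lexx.
  have [|d d0 H] := loc a; first by rewrite lexx.
  by apply: H => //; lra.
have supS : has_sup S by split; [exists a|exists b => t [/andP[]]].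
have [c1 c2] : a <= sup S /\ sup S <= b.
  split; first exact: ub_le_sup supS.2 _ Sa.
  by apply: ge_sup; [exists a|move=> t [/andP[]]].
set c := sup S in c1 c2.
have [|d d0 H] := loc c; first by rewrite c1.
have [t [/andP[at_ tb] Pt] ct] := sup_adherent d0 supS.
have tc : t <= c by apply: ub_le_sup; [exact: supS.2|split=> //; rewrite at_].
have main u : c <= u -> u <= b -> u < c + d -> P a u.
  by move=> cu ub uc; apply: (tr a t u) => //; [lra|exact: H].
have [cb|bc] := ltP c b; last by apply: main; lra.
exfalso.
pose u := Num.min b (c + d / 2).
have ub : u <= b by rewrite ge_min lexx.
have ucd : u <= c + d / 2 by rewrite ge_min lexx orbT.
have cu : c < u by rewrite lt_min cb; lra.
suff : u <= c by lra.
apply: ub_le_sup; first exact: supS.2.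
by split; [apply/andP; split; lra|apply: main; lra].
Qed.

End Cousin.

Section CoordinateMeanValue.
Context {R : realType} {n : nat}.
Implicit Types (f : 'rV[R]_n -> R) (x y z w : 'rV[R]_n).

Lemma line_is_derive f w (i : 'I_n) (t : R) :
  (forall x, derivable f x (evec R i)) ->
  is_derive t (1 : R) (fun s => f (w + s *: evec R i)) (partial f i (w + t *: evec R i)).
Proof.
move=> df.
have E : (fun h : R => h^-1 *: (((fun s => f (w + s *: evec R i)) \o shift t) (h *: 1) -
     f (w + t *: evec R i))) =
  (fun h => h^-1 *: ((f \o shift (w + t *: evec R i)) (h *: evec R i) -
     f (w + t *: evec R i))).
  apply/funext => h /=; congr (_ *: (f _ - _)).
  by rewrite [h *: 1]mulr1 scalerDl addrCA.
have d' := df (w + t *: evec R i).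
split; first by rewrite /derivable E.
by rewrite /derive /partial /derive E.
Qed.

(** Mean value theorem along one axis. The two conditions on [t] say that it lies between 0 and [c],
    whatever the sign of [c]. *)
Lemma partial_increment f w (i : 'I_n) (c m e : R) :
  (forall x, derivable f x (evec R i)) ->
  (forall t, 0 <= t * c -> `|t| <= `|c| ->
    `|partial f i (w + t *: evec R i) - m| <= e) ->
  `|f (w + c *: evec R i) - f w - m * c| <= e * `|c|.
Proof.
move=> df H.
pose h s := f (w + s *: evec R i).
pose dh s := partial f i (w + s *: evec R i).
have hd (s : R) : is_derive s (1 : R) h (dh s) by exact: line_is_derive.
have hc A : {within A, continuous h}.
  apply: continuous_subspaceT => s.
  by apply/differentiable_continuous/derivable1_diffP; case: (hd s).
have h0 : h 0 = f w by rewrite /h scale0r addr0.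
rewrite -h0 -/(h c).
have [c0|c0|<-] := ltgtP 0 c.
- have [s /[!in_itv]/= /andP[s0 sc] ->] := MVT c0 (fun s _ => hd s) (hc _).
  rewrite subr0 -mulrBl normrM; apply: ler_wpM2r => //.
  by apply: H; [rewrite mulr_ge0// ltW|rewrite !gtr0_norm// ltW].
- have [s /[!in_itv]/= /andP[s0 sc] e1] := MVT c0 (fun s _ => hd s) (hc _).
  have -> : h c - h 0 - m * c = (dh s - m) * c.
    by move: e1; lra.
  rewrite normrM; apply: ler_wpM2r => //.
  by apply: H; [rewrite nmulr_lge0// ltW|rewrite !ltr0_norm// lerN2 ltW].
- by rewrite subrr mulr0 subrr normr0 mulr0.
Qed.

(** [C1] speaks only of partial derivatives, so [x] is turned into [y] one coordinate at a time. The
    neighbourhood is a box in coordinates and therefore contains all the intermediate points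
    [w k]. *)
Lemma C1_increment f z (e : R) : C1 f -> 0 < e -> exists2 d, 0 < d &
  (forall w i, (forall j, `|w 0 j - z 0 j| < d) ->
    `|partial f i w - partial f i z| <= e) /\
  (forall x y, (forall j, `|x 0 j - z 0 j| < d) -> (forall j, `|y 0 j - z 0 j| < d) ->
    `|f y - f x - \sum_i partial f i z * (y 0 i - x 0 i)| <=
    e * \sum_i `|y 0 i - x 0 i|).
Proof.
move=> [df cf] e0.
have : \forall w \near z, forall i, `|partial f i w - partial f i z| <= e.
  apply: (@filter_forall _ _ (fun i (w : 'rV[R]_n) =>
    `|partial f i w - partial f i z| <= e) (nbhs z) _) => i.
  have /cvgrPdist_le/(_ _ e0) := cf i z.
  by apply: filterS => w; rewrite distrC.
move=> /nbhs_ballP[d /= d0 Hd].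
have H1 w i : (forall j, `|w 0 j - z 0 j| < d) ->
    `|partial f i w - partial f i z| <= e.
  move=> wz; apply: Hd; split => // i0 j; rewrite ord1.
  by rewrite /ball/= distrC.
exists d => //; split => // x y xz yz.
pose w (k : nat) : 'rV[R]_n := \row_i (if (i < k)%N then y 0 i else x 0 i).
have wS (k : 'I_n) : w k.+1 = w k + (y 0 k - x 0 k) *: evec R k.
  apply/rowP => i; rewrite !mxE eqxx/= ltnS leq_eqVlt.
  have [ik|ik] := eqVneq i k; first by subst i; rewrite eqxx ltnn/=; ring.
  have -> : (nat_of_ord i == k) = false by exact: negbTE.
  by rewrite mulr0 addr0.
have -> : f y - f x = \sum_(k < n) (f (w k.+1) - f (w k)).
  rewrite -(big_mkord xpredT (fun k => f (w k.+1) - f (w k))) telescope_sumr//.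
  by congr (f _ - f _); apply/rowP => i; rewrite mxE ?ltn_ord.
rewrite -sumrB mulr_sumr; apply: le_trans (ler_norm_sum _ _ _) _.
apply: ler_sum => k _; rewrite wS; apply: partial_increment => // t tc tlc.
apply: H1 => j; rewrite !mxE eqxx/=.
have [jk|jk] := eqVneq j k; last first.
  by rewrite mulr0 addr0; case: ifP.
subst j; rewrite ltnn mulr1.
have := xz k; have := yz k; rewrite !ltr_norml => /andP[y1 y2] /andP[x1 x2].
have [c0|c0] := leP 0 (y 0 k - x 0 k).
  have t0 : 0 <= t \/ y 0 k - x 0 k = 0.
    by have [|t0] := leP 0 t; [left|right; nra].
  have := tlc; rewrite (ger0_norm c0) ler_norml => /andP[? ?].
  by case: t0 => ?; apply/andP; split; lra.
have t0 : t <= 0 by nra.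
have := tlc; rewrite (ltr0_norm c0) ler_norml => /andP[? ?].
by apply/andP; split; lra.
Qed.

End CoordinateMeanValue.

Section RealIntegrable.
Context {R : realType}.
Local Notation mu := (@lebesgue_measure R).
Implicit Types (D : set (measurableTypeR R)) (f g : R -> R).

Lemma integrableZ D (k : R) f : measurable D -> mu.-integrable D (EFin \o f) ->
  mu.-integrable D (EFin \o (fun t => k * f t)).
Proof.
move=> mD fi; rewrite (_ : EFin \o _ = fun t => (k%:E * (EFin \o f) t)%E)//.
exact: integrableZl.
Qed.

Lemma integrableRB D f g : measurable D -> mu.-integrable D (EFin \o f) ->
  mu.-integrable D (EFin \o g) ->
  mu.-integrable D (EFin \o (fun t => f t - g t)).
Proof.
move=> mD fi gi.
rewrite (_ : EFin \o _ = fun t => ((EFin \o f) t - (EFin \o g) t)%E)//.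
exact: integrableB.
Qed.

Lemma integrableRD D f g : measurable D -> mu.-integrable D (EFin \o f) ->
  mu.-integrable D (EFin \o g) ->
  mu.-integrable D (EFin \o (fun t => f t + g t)).
Proof.
move=> mD fi gi.
rewrite (_ : EFin \o _ = fun t => ((EFin \o f) t + (EFin \o g) t)%E)//.
exact: integrableD.
Qed.

End RealIntegrable.

Section ChainRule.
Context {R : realType} {n : nat}.
Local Notation mu := (@lebesgue_measure R).
Implicit Types phi g : R -> 'rV[R]_n.

Lemma sqint_grad_prim a b phi g (f : 'rV[R]_n -> R) i : a <= b ->
  C1 f -> prim a b phi g -> sqint `[a, b] (fun t => grad f (phi t) 0 i).
Proof.
move=> ab [_ cf] pg; apply: (@eq_sqint _ _ (partial f i \o phi)) => //.
  by move=> t _; rewrite /grad mxE.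
exact: sqint_comp_prim pg (cf i).
Qed.

(** Both sides are additive in the interval, and on small intervals they differ by at most [(e + e)]
    times the integral of [G]. [interval_local_to_global] turns this into a bound on [[a, b]], and
    [e] is arbitrary. *)
Lemma chain_rule (a b : R) phi g (f : 'rV[R]_n -> R) : a <= b ->
  C1 f -> prim a b phi g ->
  f (phi b) - f (phi a) = \int[mu]_(t in `[a, b]) dotv (grad f (phi t)) (g t).
Proof.
move=> ab Cf pg.
pose D t := dotv (grad f (phi t)) (g t).
pose G t := \sum_i `|g t 0 i|.
have ig i : mu.-integrable `[a, b] (EFin \o (fun t => g t 0 i)).
  by apply: sqint_integrable; case: (pg i).
have iD : mu.-integrable `[a, b] (EFin \o D).
  apply: integrable_dotv => // i; last by case: (pg i).
  exact: sqint_grad_prim pg.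
have iG : mu.-integrable `[a, b] (EFin \o G).
  by apply: integrable_Rsum => // i; apply: integrable_norm.
have loc e : 0 < e -> `|f (phi b) - f (phi a) - \int[mu]_(t in `[a, b]) D t| <=
    (e + e) * \int[mu]_(t in `[a, b]) G t.
  move=> e0.
  pose P s t := `|f (phi t) - f (phi s) - \int[mu]_(u in `[s, t]) D u| <=
    (e + e) * \int[mu]_(u in `[s, t]) G u.
  apply: (@interval_local_to_global R P) => //.
    move=> s m t as_ sm mt tb; rewrite /P => Psm Pmt.
    have smt : s <= m <= t by rewrite sm.
    rewrite (Rintegral_itv_split smt); last exact: integrable_itvS iD.
    rewrite (Rintegral_itv_split smt); last exact: integrable_itvS iG.
    rewrite mulrDr; apply: le_trans (lerD Psm Pmt).
    by apply: le_trans (ler_normD _ _); rewrite le_eqVlt; apply/orP; left;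
      apply/eqP; congr (`|_|); ring.
  move=> x axb; have [d d0 [H1 H2]] := C1_increment (phi x) Cf e0.
  have [r r0 Hr] := prim_unif pg d0.
  exists r => // s t as_ sx xt tb sr tr.
  have near_x u : s <= u -> u <= t -> forall j, `|phi u 0 j - phi x 0 j| < d.
    move=> su ut j; apply: (@le_lt_trans _ _ (enorm (phi u - phi x))).
      by have := coord_le_enorm (phi u - phi x) j; rewrite !mxE.
    apply: Hr => //; first by apply/andP; split; lra.
    by rewrite ltr_norml; apply/andP; split; lra.
  have st : s <= t by lra.
  have iS (k : R -> R) : mu.-integrable `[a, b] (EFin \o k) ->
      mu.-integrable `[s, t] (EFin \o k) by exact: integrable_itvS.
  have dphi i : phi t 0 i - phi s 0 i = \int[mu]_(u in `[s, t]) g u 0 i.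
    by case: (pg i) => _; apply.
  have sumG : \sum_i `|phi t 0 i - phi s 0 i| <= \int[mu]_(u in `[s, t]) G u.
    rewrite Rintegral_sum//; last by move=> i; apply/integrable_norm/iS/ig.
    apply: ler_sum => i _; rewrite dphi; apply: le_normr_Rintegral => //.
    exact/iS/ig.
  have A1 := H2 _ _ (near_x s (lexx _) st) (near_x t st (lexx _)).
  (* [K] has the gradient frozen at [phi x]: [A1] compares its integral with the increment of [f],
     [A2] with the integral of [D]. *)
  pose K u := \sum_i partial f i (phi x) * g u 0 i.
  have iZ i : mu.-integrable `[s, t] (EFin \o (fun u => partial f i (phi x) * g u 0 i)).
    exact/integrableZ/iS/ig.
  have iK : mu.-integrable `[s, t] (EFin \o K) by exact: integrable_Rsum.
  have KE : \sum_i partial f i (phi x) * (phi t 0 i - phi s 0 i) =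
      \int[mu]_(u in `[s, t]) K u.
    rewrite Rintegral_sum//; apply: eq_bigr => i _.
    by rewrite RintegralZl// ?dphi//; exact/iS/ig.
  have A2 : `|\int[mu]_(u in `[s, t]) K u - \int[mu]_(u in `[s, t]) D u| <=
      e * \int[mu]_(u in `[s, t]) G u.
    rewrite -RintegralB//; last exact: iS.
    apply: le_trans (le_normr_Rintegral _ _) _ => //.
      by apply: integrableRB => //; exact: iS.
    rewrite -RintegralZl//; last exact: iS.
    apply: le_Rintegral => //.
    - apply: integrable_norm.
      by apply: integrableRB => //; exact: iS.
    - by apply: integrableZ => //; exact: iS.
    - move=> u /=; rewrite in_itv/= => /andP[su ut].
      rewrite /K /D /G /dotv -sumrB mulr_sumr.
      apply: le_trans (ler_norm_sum _ _ _) _; apply: ler_sum => i _.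
      rewrite /grad mxE -mulrBl normrM; apply: ler_wpM2r => //.
      by rewrite distrC; apply: H1; exact: near_x.
  rewrite /P mulrDl.
  have -> : f (phi t) - f (phi s) - \int[mu]_(u in `[s, t]) D u =
    (f (phi t) - f (phi s) - \sum_i partial f i (phi x) * (phi t 0 i - phi s 0 i))
    + (\int[mu]_(u in `[s, t]) K u - \int[mu]_(u in `[s, t]) D u).
    by rewrite KE; ring.
  apply: le_trans (ler_normD _ _) _; apply: lerD => //.
  by apply: le_trans A1 _; rewrite ler_pM2l.
have G0 : 0 <= \int[mu]_(t in `[a, b]) G t.
  by apply: Rintegral_ge0 => t _; exact: sumr_ge0.
apply/eqP; rewrite -subr_eq0 -normr_le0; apply/ler_addgt0Pl => e e0.
rewrite addr0.
set I := \int[mu]_(t in `[a, b]) G t in loc G0.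
have d0 : 0 < e / (2 * (I + 1)) by rewrite divr_gt0// mulr_gt0// ltr_wpDl.
apply: le_trans (loc _ d0) _.
set r := e / _ in d0 *.
have : r * (2 * (I + 1)) = e by rewrite divfK// gt_eqF// mulr_gt0// ltr_wpDl.
by move: d0; lra.
Qed.

End ChainRule.

(** * Shift, reversal and concatenation of paths *)

Section RealLineOperations.
Context {R : realType}.
Local Notation mu := (@lebesgue_measure R).
Implicit Types (f g : R -> R) (a b m h : R).

Lemma Rintegral_shift a b h f : mu.-integrable `[a, b] (EFin \o f) ->
  \int[mu]_(t in `[a - h, b - h]) f (t + h) = \int[mu]_(t in `[a, b]) f t.
Proof.
move=> fi; rewrite (@Rintegral_affine R 1 h (oner_neq0 _) `[a, b]%classic)//.
rewrite preimage_affine_itv// !divr1 normr1 mul1r.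
by apply: eq_Rintegral => t _; rewrite mul1r.
Qed.

Lemma sqint_shift a b h f : sqint `[a, b] f ->
  sqint `[a - h, b - h] (fun t => f (t + h)).
Proof.
move=> /(sqint_affine h (oner_neq0 R) (measurable_itv _)).
rewrite preimage_affine_itv// !divr1; apply: eq_sqint => // t _.
by rewrite mul1r.
Qed.

Let N1_neq0 : (-1 : R) != 0. Proof. by rewrite oppr_eq0 oner_neq0. Qed.

Lemma Rintegral_reflect a b h f : mu.-integrable `[a, b] (EFin \o f) ->
  \int[mu]_(t in `[h - b, h - a]) f (h - t) = \int[mu]_(t in `[a, b]) f t.
Proof.
move=> fi; rewrite (@Rintegral_affine R (-1) h N1_neq0 `[a, b]%classic)//.
rewrite preimage_opp_itv normrN1 mul1r.
by apply: eq_Rintegral => t _; rewrite mulN1r addrC.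
Qed.

Lemma sqint_reflect a b h f : sqint `[a, b] f ->
  sqint `[h - b, h - a] (fun t => f (h - t)).
Proof.
move=> /(sqint_affine h N1_neq0 (measurable_itv _)).
rewrite preimage_opp_itv; apply: eq_sqint => // t _.
by rewrite mulN1r addrC.
Qed.

Lemma Rintegral_scale k f : 0 < k -> mu.-integrable `[0, 1] (EFin \o f) ->
  \int[mu]_(t in `[0, k]) (k^-1 * f (t / k)) = \int[mu]_(t in `[0, 1]) f t.
Proof.
move=> k0 fi; have ki0 : 0 < k^-1 by rewrite invr_gt0.
have kn : k^-1 != 0 by rewrite gt_eqF.
have E : (fun t : R => k^-1 * t + 0) @^-1` `[0, 1] = `[0, k]%classic.
  by rewrite preimage_affine_itv// invrK !subr0 mul0r mul1r.
rewrite (@Rintegral_affine R k^-1 0 kn `[0, 1]%classic)// E.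
have := @integrable_affine R k^-1 0 kn `[0, 1]%classic f (measurable_itv _) fi.
rewrite E => fi'; rewrite gtr0_norm// -RintegralZl//.
by apply: eq_Rintegral => t _; rewrite addr0 [t / k]mulrC.
Qed.

(** The exempt left endpoint is the time at which [glue] still follows its first path. *)
Lemma Rintegral_itv_eqo a b f g : (forall t, a < t <= b -> f t = g t) ->
  \int[mu]_(t in `[a, b]) f t = \int[mu]_(t in `[a, b]) g t.
Proof.
move=> fg; rewrite /Rintegral; congr fine.
apply: (@integral_eq_off_null _ _ _ mu _ [set a]).
- exact: measurable_set1.
- exact: lebesgue_measure_set1.
- move=> t; rewrite /= in_itv/= => /andP[at_ tb] ta; rewrite fg// lt_neqAle.
  by rewrite at_ tb !andbT; apply/eqP => e; apply: ta.
Qed.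

Lemma sqint_itv_eqo a b f g : a <= b -> (forall t, a < t <= b -> f t = g t) ->
  sqint `[a, b] f -> sqint `[a, b] g.
Proof.
move=> ab fg [mf f2].
have close (u v : R -> R) : (forall t, a < t <= b -> u t = v t) ->
    measurable_fun `[a, b] u -> measurable_fun `[a, b] v.
  move=> uv mu_.
  rewrite -(setU1itv false)//; apply/measurable_funU => //.
  split; first exact: measurable_fun_set1.
  apply: (@eq_measurable_fun _ _ _ _ _ u).
    by move=> t; rewrite inE/= in_itv/=; exact: uv.
  by apply: measurable_funS mu_ => //; apply: subset_itvr; rewrite bnd_simp.
have mg : measurable_fun `[a, b] g by exact: close mf.
split => //; apply/integrableP; split.
  by apply/measurable_EFinP; exact: measurable_funX.
have [_ foo] := integrableP _ _ _ f2.
rewrite (@integral_eq_off_null _ _ _ mu _ [set a] _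
  (fun t => `|(EFin \o (fun t => (f t ^+ 2)%R)) t|%E))//.
  exact: lebesgue_measure_set1.
move=> t; rewrite /= in_itv/= => /andP[at_ tb] ta; rewrite fg// lt_neqAle.
by rewrite at_ tb !andbT; apply/eqP => e; apply: ta.
Qed.

End RealLineOperations.

Section PrimOperations.
Context {R : realType} {n : nat}.
Local Notation mu := (@lebesgue_measure R).
Implicit Types phi g : R -> 'rV[R]_n.

Lemma primS a b c d phi g : a <= c -> d <= b -> prim a b phi g ->
  prim c d phi g.
Proof.
move=> ac db pg i; have [sg ph] := pg i; split; first exact: sqint_itvS sg.
by move=> s t cs st td; apply: ph => //; [exact: le_trans cs|exact: le_trans db].
Qed.

Lemma prim_shift a b h phi g : prim a b phi g ->
  prim (a - h) (b - h) (fun t => phi (t + h)) (fun t => g (t + h)).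
Proof.
move=> pg i; have [sg ph] := pg i; split; first exact: (sqint_shift h sg).
move=> s t as_ st tb.
rewrite ph; [|lra|lra|lra].
rewrite -(@Rintegral_shift _ (s + h) (t + h) h); last first.
  by apply: integrable_itvS (sqint_integrable sg); lra.
by rewrite !addrK.
Qed.

Lemma prim_reflect a b h phi g : prim a b phi g ->
  prim (h - b) (h - a) (fun t => phi (h - t)) (fun t => - g (h - t)).
Proof.
move=> pg i; have [sg ph] := pg i; split.
  have := sqintZ (-1) (measurable_itv _) (sqint_reflect h sg).
  by apply: eq_sqint => // t _; rewrite mxE mulN1r.
move=> s t as_ st tb.
have -> : phi (h - t) 0 i - phi (h - s) 0 i =
    - (phi (h - s) 0 i - phi (h - t) 0 i) by ring.
rewrite ph; [|lra|lra|lra].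
have ig : mu.-integrable `[h - t, h - s] (EFin \o (fun t => g t 0 i)).
  by apply: integrable_itvS (sqint_integrable sg); lra.
rewrite -(Rintegral_reflect h ig) !subKr -mulN1r -RintegralZl//.
  by apply: eq_Rintegral => u _; rewrite mxE mulN1r.
have : sqint `[s, t] (fun u => g (h - u) 0 i).
  by have := sqint_itvS as_ tb (sqint_reflect h sg).
exact: sqint_integrable.
Qed.

Definition glue m (f1 f2 : R -> 'rV[R]_n) t := if t <= m then f1 t else f2 t.

Lemma prim_glue a m b phi1 g1 phi2 g2 : a <= m <= b ->
  prim a m phi1 g1 -> prim m b phi2 g2 -> phi1 m = phi2 m ->
  prim a b (glue m phi1 phi2) (glue m g1 g2).
Proof.
move=> /andP[am mb] p1 p2 e i; have [s1 h1] := p1 i; have [s2 h2] := p2 i.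
have sg1 : sqint `[a, m] (fun t => glue m g1 g2 t 0 i).
  apply: eq_sqint s1 => // t; rewrite inE/= in_itv/= => /andP[_ tm].
  by rewrite /glue tm.
have sg2 : sqint `[m, b] (fun t => glue m g1 g2 t 0 i).
  apply: (sqint_itv_eqo mb _ s2) => t /andP[mt _].
  by rewrite /glue leNgt mt.
have sg : sqint `[a, b] (fun t => glue m g1 g2 t 0 i).
  by apply: sqint_itv_split sg1 sg2; rewrite am.
split => // s t as_ st tb.
have left_ u v : a <= u -> u <= v -> v <= m ->
    glue m phi1 phi2 v 0 i - glue m phi1 phi2 u 0 i =
    \int[mu]_(x in `[u, v]) glue m g1 g2 x 0 i.
  move=> au uv vm; rewrite /glue vm (le_trans uv vm) h1//.
  apply: eq_Rintegral => x; rewrite inE/= in_itv/= => /andP[_ xv].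
  by rewrite (le_trans xv).
have phim : glue m phi1 phi2 m = phi2 m by rewrite /glue lexx e.
have right_ u v : m <= u -> u <= v -> v <= b ->
    glue m phi1 phi2 v 0 i - glue m phi1 phi2 u 0 i =
    \int[mu]_(x in `[u, v]) glue m g1 g2 x 0 i.
  move=> mu_ uv vb.
  have E w : m <= w -> glue m phi1 phi2 w = phi2 w.
    rewrite le_eqVlt => /predU1P[<-//|mw]; by rewrite /glue leNgt mw.
  rewrite !E//; last exact: le_trans uv.
  rewrite h2//; apply: Rintegral_itv_eqo => x /andP[ux _].
  by rewrite /glue leNgt (le_lt_trans mu_ ux).
have [tm|mt] := leP t m; first exact: left_.
have [sm|ms] := leP s m; last by apply: right_ => //; exact: ltW.
rewrite (@Rintegral_itv_split _ s m t); last 2 first.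
- by rewrite sm ltW.
- by apply: integrable_itvS (sqint_integrable sg).
rewrite -left_// -right_//; [ring|exact: ltW].
Qed.

Lemma prim_line (x v : 'rV[R]_n) a b : prim a b (fun t => x + t *: v) (fun=> v).
Proof.
move=> i; split; first exact: sqint_cst.
move=> s t as_ st tb; rewrite Rintegral_cst// !mxE.
have := lebesgue_measure_itv `[s, t]; rewrite /= lte_fin => ->.
case: ltgtP st => [st _|//|-> _]; last by rewrite subrr mulr0.
by rewrite /=; ring.
Qed.

End PrimOperations.

(** * Action, energy and work *)

Section PathFunctionals.
Context {R : realType} {n : nat}.
Local Notation mu := (@lebesgue_measure R).
Local Notation vec := 'rV[R]_n.
Implicit Types (phi g : R -> vec) (F : vec -> vec -> R).

(** Integrability along every path is all that gluing, shifting, splitting and reversing need to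
    know about [F]. *)
Definition lagrangian F := forall (a b : R) phi g, a <= b -> prim a b phi g ->
  mu.-integrable `[a, b] (EFin \o (fun t => F (phi t) (g t))).

Definition functional F (a b : R) phi g := \int[mu]_(t in `[a, b]) F (phi t) (g t).

Lemma functional_glue F a m b phi1 g1 phi2 g2 : lagrangian F -> a <= m <= b ->
  prim a m phi1 g1 -> prim m b phi2 g2 -> phi1 m = phi2 m ->
  functional F a b (glue m phi1 phi2) (glue m g1 g2) =
  functional F a m phi1 g1 + functional F m b phi2 g2.
Proof.
move=> lF amb p1 p2 e; have /andP[am mb] := amb.
rewrite /functional (@Rintegral_itv_split _ a m b)//; last first.
  by apply: lF (prim_glue amb p1 p2 e); lra.
congr (_ + _).
  apply: eq_Rintegral => t; rewrite inE/= in_itv/= => /andP[_ tm].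
  by rewrite /glue tm.
by apply: Rintegral_itv_eqo => t /andP[mt _]; rewrite /glue leNgt mt.
Qed.

Lemma functional_shift F a b h phi g : lagrangian F -> a <= b ->
  prim a b phi g ->
  functional F (a - h) (b - h) (fun t => phi (t + h)) (fun t => g (t + h)) =
  functional F a b phi g.
Proof. by move=> lF ab p; rewrite /functional -(Rintegral_shift h (lF _ _ _ _ ab p)). Qed.

Lemma functional_split F a m b phi g : lagrangian F -> a <= m <= b ->
  prim a b phi g ->
  functional F a b phi g = functional F a m phi g + functional F m b phi g.
Proof.
move=> lF amb p; apply: Rintegral_itv_split => //; apply: lF p.
by case/andP: amb => am mb; exact: le_trans mb.
Qed.

Lemma functional_reflect F a b h phi g : lagrangian F -> a <= b ->
  prim a b phi g ->
  functional (fun p v => F p (- v)) (h - b) (h - a) (fun t => phi (h - t))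
    (fun t => - g (h - t)) = functional F a b phi g.
Proof.
move=> lF ab p; rewrite /functional -(Rintegral_reflect h (lF _ _ _ _ ab p)).
by apply: eq_Rintegral => t _; rewrite opprK.
Qed.

End PathFunctionals.

Section C1Continuous.
Context {R : realType} {n : nat}.

Lemma coord_le_mx_norm (u : 'rV[R]_n) i : `|u 0 i| <= `|u|.
Proof.
rewrite [leRHS]/Num.Def.normr/= mx_normrE.
exact: (le_bigmax _ (fun ij : 'I_1 * 'I_n => `|u ij.1 ij.2|) (0, i)).
Qed.

Lemma C1_continuous (f : 'rV[R]_n -> R) : C1 f -> continuous f.
Proof.
move=> Cf z; apply/(@cvgrPdist_lt _ _ _ _ (nbhs_filter z)) => e e0.
have [d d0 [_ H]] := C1_increment z Cf (@ltr01 R).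
pose K := \sum_i (`|partial f i z| + 1) + 1.
have K0 : 0 < K by rewrite ltr_wpDl// sumr_ge0// => i _; rewrite addr_ge0.
pose r := Num.min d (e / K).
have r0 : 0 < r by rewrite lt_min d0 divr_gt0.
have rd : r <= d by rewrite ge_min lexx.
have rK : K * r <= e by rewrite mulrC -ler_pdivlMr// ge_min lexx orbT.
apply/nbhs_ballP; exists r => // y [_ zy].
have yz i : `|y 0 i - z 0 i| < r by have := zy 0 i; rewrite /ball/= distrC.
have z0 i : `|z 0 i - z 0 i| < d by rewrite subrr normr0.
have {}H := H z y z0 (fun j => lt_le_trans (yz j) rd).
rewrite distrC.
have : `|f y - f z| <= \sum_i (`|partial f i z| + 1) * r.
  apply: (@le_trans _ _ (`|f y - f z - \sum_i partial f i z * (y 0 i - z 0 i)| +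
    `|\sum_i partial f i z * (y 0 i - z 0 i)|)).
    by apply: le_trans (ler_normD _ _); rewrite subrK.
  apply: le_trans (lerD H (ler_norm_sum _ _ _)) _.
  rewrite mul1r -big_split/=; apply: ler_sum => i _.
  rewrite mulrDl mul1r addrC normrM; apply: lerD; last exact: ltW.
  by apply: ler_wpM2l => //; exact: ltW.
move/le_lt_trans; apply; rewrite -mulr_suml; apply: lt_le_trans rK.
by rewrite ltr_pM2r// /K ltrDl.
Qed.

End C1Continuous.

Section Action.
Context {R : realType} {n : nat}.
Local Notation mu := (@lebesgue_measure R).
Local Notation vec := 'rV[R]_n.
Variables (V : vec -> R) (b : vec -> vec).
Hypotheses (C2V : C2 V) (C1b : C1field b).
Hypothesis orth : forall x, dotv (grad V x) (b x) = 0.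
Implicit Types (phi g : R -> vec).

Let C1V : C1 V. Proof. exact: C2V.1. Qed.

Lemma sqint_field_prim a d phi g i : a <= d -> prim a d phi g ->
  sqint `[a, d] (fun t => b (phi t) 0 i).
Proof.
move=> ad p; apply: (@sqint_comp_prim _ _ _ _ _ _ (fun x => b x 0 i) ad p).
exact/C1_continuous/C1b.
Qed.

Lemma sqint_cfield_prim a d phi g i : a <= d -> prim a d phi g ->
  sqint `[a, d] (fun t => cfield V b (phi t) 0 i).
Proof.
move=> ad p.
have s1 := sqintZ (- 2^-1) (measurable_itv _) (sqint_grad_prim i ad C1V p).
have := sqintD (measurable_itv _) s1 (sqint_field_prim i ad p).
by apply: eq_sqint => // t _; rewrite /cfield !mxE; ring.
Qed.

Definition Lact (p v : vec) : R := sqn (v - cfield V b p).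
Definition Llin (p v : vec) : R := dotv (b p) v.
(** Even in [v], hence invariant under time reversal. Under [orth] the bracket is the squared norm
    of [cfield V b p]. *)
Definition Len (p v : vec) : R := sqn v + (4^-1 * sqn (grad V p) + sqn (b p)).

Lemma lagrangian_act : lagrangian Lact.
Proof.
move=> a d phi g ad p.
have s i : sqint `[a, d] (fun t => (g t - cfield V b (phi t)) 0 i).
  have := sqintB (measurable_itv _) (p i).1 (sqint_cfield_prim i ad p).
  by apply: eq_sqint => // t _; rewrite !mxE.
by apply: integrable_dotv.
Qed.

Lemma lagrangian_lin : lagrangian Llin.
Proof.
move=> a d phi g ad p; apply: integrable_dotv => // i; last by case: (p i).
exact: sqint_field_prim p.
Qed.

Lemma lagrangian_grad : lagrangian (fun p v => dotv (grad V p) v).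
Proof.
move=> a d phi g ad p; apply: integrable_dotv => // i; last by case: (p i).
exact: sqint_grad_prim p.
Qed.

Lemma lagrangian_energy : lagrangian Len.
Proof.
move=> a d phi g ad p.
have s1 : mu.-integrable `[a, d] (EFin \o (fun t => sqn (g t))).
  by apply: integrable_dotv => // i; case: (p i).
have s2 : mu.-integrable `[a, d] (EFin \o (fun t => sqn (grad V (phi t)))).
  by apply: integrable_dotv => // i; exact: sqint_grad_prim p.
have s3 : mu.-integrable `[a, d] (EFin \o (fun t => sqn (b (phi t)))).
  by apply: integrable_dotv => // i; exact: sqint_field_prim p.
apply: integrableRD => //; apply: integrableRD => //; exact: integrableZ.
Qed.

Definition act (a d : R) phi g := 2^-1 * functional Lact a d phi g.
Definition lin (a d : R) phi g := functional Llin a d phi g.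
Definition energy (a d : R) phi g := 2^-1 * functional Len a d phi g.

Lemma Lact_expand p v :
  Lact p v = Len p v + (dotv (grad V p) v - 2 * Llin p v).
Proof.
have E : Lact p v =
    Len p v + (dotv (grad V p) v - 2 * Llin p v) - dotv (grad V p) (b p).
  rewrite /Lact /Len /Llin /sqn /dotv !mulr_sumr -!sumrB -!big_split/= -sumrB.
  by apply: eq_bigr => i _; rewrite /cfield !mxE; field.
by rewrite E orth subr0.
Qed.

(* The cross term [grad V . b] vanishes, so the action splits into the
   time-reversal invariant energy, a boundary term and the work of [b]. *)
Lemma act_energy a d phi g : a <= d -> prim a d phi g ->
  act a d phi g =
  energy a d phi g + 2^-1 * (V (phi d) - V (phi a)) - lin a d phi g.
Proof.
move=> ad p; rewrite (chain_rule ad C1V p) /act /energy /lin /functional.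
have i1 := lagrangian_energy ad p; have i2 := lagrangian_grad ad p.
have i3 := lagrangian_lin ad p.
have i4 := integrableZ 2 (measurable_itv _) i3.
have -> : \int[mu]_(t in `[a, d]) Lact (phi t) (g t) =
    \int[mu]_(t in `[a, d]) Len (phi t) (g t) +
    (\int[mu]_(t in `[a, d]) dotv (grad V (phi t)) (g t) -
    2 * \int[mu]_(t in `[a, d]) Llin (phi t) (g t)).
  rewrite -RintegralZl// -RintegralB// -RintegralD//; last exact: integrableRB.
  by apply: eq_Rintegral => t _; rewrite Lact_expand.
by field.
Qed.

Lemma act_ge0 a d phi g : 0 <= act a d phi g.
Proof.
by rewrite mulr_ge0// Rintegral_ge0// => t _; exact: sqn_ge0.
Qed.

Lemma prim_HT T phi g : 0 <= T -> prim 0 T phi g -> HT T phi.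
Proof.
move=> T0 p; split; first exact: prim_abs_cont p.
have [N [mN N0 NE]] := prim_derive1 p.
rewrite (@integral_eq_off_null _ _ _ mu _ N _ (fun t => (sqn (g t))%:E) mN N0).
  have i : mu.-integrable `[0, T] (EFin \o (fun t => sqn (g t))).
    by apply: integrable_dotv => // i; case: (p i).
  exact: integrable_lty.
by move=> t; rewrite /= in_itv/= => tT nN; rewrite NE.
Qed.

Lemma IT_act T phi g : 0 <= T -> prim 0 T phi g ->
  IT V b (phi 0) T phi = (act 0 T phi g)%:E.
Proof.
move=> T0 p; rewrite /IT asboolT; last by split => //; exact: prim_HT p.
have [N [mN N0 NE]] := prim_derive1 p.
rewrite (@integral_eq_off_null _ _ _ mu _ N _
  (fun t => (Lact (phi t) (g t))%:E) mN N0); last first.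
  by move=> t; rewrite /= in_itv/= => tT nN; rewrite NE.
rewrite /act EFinM /functional /Rintegral fineK//.
by apply: integrable_fin_num => //; exact: lagrangian_act p.
Qed.

Lemma LT_lin T phi g : 0 <= T -> prim 0 T phi g ->
  LT b T phi = 2 / T * lin 0 T phi g.
Proof.
move=> T0 p; rewrite /LT /lin /functional; congr (_ * _).
have [N [mN N0 NE]] := prim_derive1 p.
congr fine; apply: (@integral_eq_off_null _ _ _ mu _ N _ _ mN N0).
by move=> t; rewrite /= in_itv/= => tT nN; rewrite NE.
Qed.

End Action.

(** * Controlled loops *)

Lemma continuous_bounded_rV {R : realType} {n : nat} (f : 'rV[R]_n -> R) (r : R) :
  continuous f -> exists C, 0 <= C /\ forall x, `|x| <= r -> `|f x| <= C.
Proof.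
move=> cf.
have cK : compact [set v : 'rV[R]_n | forall i, `[- r, r]%classic (v ord0 i)].
  by apply: (@rV_compact R n (fun=> `[- r, r]%classic)) => i; exact: segment_compact.
have [M [_ HM]] := compact_bounded (continuous_compact (continuous_subspaceT cf) cK).
exists (`|M| + 1); split; first by rewrite addr_ge0.
move=> x xr; apply: (HM (`|M| + 1)).
  by rewrite (le_lt_trans (ler_norm M))// ltrDl.
exists x => // i /=; rewrite in_itv/= -ler_norml.
exact: le_trans (coord_le_mx_norm x i) xr.
Qed.

Section Reach.
Context {R : realType} {n : nat}.
Local Notation mu := (@lebesgue_measure R).
Local Notation vec := 'rV[R]_n.
Variables (V : vec -> R) (b : vec -> vec).
Hypotheses (C2V : C2 V) (C1b : C1field b).
Hypothesis orth : forall x, dotv (grad V x) (b x) = 0.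
Hypothesis bb : bounded_field b.
Implicit Types (phi g : R -> vec) (x y z : vec) (T l E : R).

(** The work [l] is not normalised by time, so that it adds under concatenation; the constraint
    [LT b T phi = q] reads [l = q * T / 2]. The action is only bounded by [E], so that estimates can
    be weakened. *)
Definition reach x y T l E := exists phi g, [/\ prim 0 T phi g, phi 0 = x,
  phi T = y, lin b 0 T phi g = l & act V b 0 T phi g <= E].

Lemma reach_le x y T l E E' : E <= E' -> reach x y T l E -> reach x y T l E'.
Proof.
by move=> EE [phi [g [p h0 hT hl ha]]]; exists phi, g; split => //; exact: le_trans EE.
Qed.

Lemma reach_ge0 x y T l E : reach x y T l E -> 0 <= E.
Proof. by move=> [phi [g [_ _ _ _]]]; apply: le_trans; exact: act_ge0. Qed.

Lemma reach_cat x y z T1 T2 l1 l2 E1 E2 : 0 <= T1 -> 0 <= T2 ->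
  reach x y T1 l1 E1 -> reach y z T2 l2 E2 ->
  reach x z (T1 + T2) (l1 + l2) (E1 + E2).
Proof.
move=> T10 T20 [f1 [g1 [p1 a1 b1 c1 d1]]] [f2 [g2 [p2 a2 b2 c2 d2]]].
have p2' := prim_shift (- T1) p2.
rewrite opprK add0r addrC in p2'.
have lT : 0 <= T1 <= T1 + T2 by rewrite T10 lerDl.
have e : f1 T1 = f2 (T1 + - T1) by rewrite subrr a2 b1.
have fs F : lagrangian F -> functional F T1 (T1 + T2) (fun t => f2 (t - T1))
    (fun t => g2 (t - T1)) = functional F 0 T2 f2 g2.
  move=> lF; have := functional_shift (- T1) lF T20 p2.
  by rewrite opprK add0r [T2 + T1]addrC.
exists (glue T1 f1 (fun t => f2 (t - T1))), (glue T1 g1 (fun t => g2 (t - T1))).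
split.
- exact: prim_glue.
- by rewrite /glue T10.
(* When [T2 = 0] the glued path still follows [f1] at its final time. *)
- rewrite /glue; case: leP => [le|_]; last by rewrite addrAC subrr add0r.
  have T2E : T2 = 0 by apply/eqP; rewrite eq_le T20 andbT -(lerD2l T1) addr0.
  by rewrite T2E addr0 b1 -a2 -b2 T2E.
- have lL := lagrangian_lin C1b.
  by rewrite /lin (functional_glue lL lT p1 p2' e) fs// -c1 -c2.
- have lA := lagrangian_act C2V C1b.
  rewrite /act (functional_glue lA lT p1 p2' e) fs// mulrDr.
  exact: lerD.
Qed.

Lemma reach_stay x T : 0 <= T -> reach x x T 0 (2^-1 * (sqn (cfield V b x) * T)).
Proof.
move=> T0; exists (fun t => x + t *: 0), (fun=> 0); split.
- exact: prim_line.
- by rewrite scaler0 addr0.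
- by rewrite scaler0 addr0.
- rewrite /lin /functional (@eq_Rintegral _ _ _ _ _ (fun=> 0)).
    by rewrite Rintegral_cst// mul0r.
  by move=> t _; rewrite /Llin /dotv big1// => i _; rewrite !mxE mulr0.
- rewrite /act /functional (@eq_Rintegral _ _ _ _ _ (fun=> sqn (cfield V b x))).
    rewrite Rintegral_cst//.
    have := lebesgue_measure_itv `[0, T]; rewrite /= lte_fin => ->.
    by case: ltgtP T0 => //= [_ _|<- _]; rewrite ?subr0 ?mulr0.
  move=> t _; rewrite /Lact scaler0 addr0 sub0r /sqn /dotv.
  by apply: eq_bigr => i _; rewrite !mxE mulrNN.
Qed.

Lemma reach_iter x T l E (m : nat) : 0 <= T -> reach x x T l E ->
  reach x x (m%:R * T) (m%:R * l) (m%:R * E).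
Proof.
move=> T0 r; elim: m => [|m ih].
  by rewrite !mul0r; have := @reach_stay x 0 (lexx _); rewrite !mulr0.
rewrite -natr1 !mulrDl !mul1r; apply: reach_cat ih r => //.
by rewrite mulr_ge0.
Qed.

(** On a loop the increment of [V] vanishes, so the action is energy minus work. Reversal keeps the
    energy and turns the work [l] into [- l], which raises the action by [2 * l]. *)
Lemma reach_loopN x T l E : 0 <= T -> reach x x T l E ->
  reach x x T (- l) (E + 2 * l).
Proof.
move=> T0 [f [g [p a0 aT hl ha]]].
have p' := prim_reflect T p; rewrite subrr subr0 in p'.
have lL := lagrangian_lin C1b; have lE := lagrangian_energy C2V C1b.
have linE : lin b 0 T (fun t => f (T - t)) (fun t => - g (T - t)) = - l.
  have lL' : lagrangian (fun p v => - Llin b p v).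
    move=> c d phi h cd q; have := integrableZ (-1) (measurable_itv _) (lL _ _ _ _ cd q).
    by apply: eq_integrable => // t _ /=; rewrite mulN1r.
  have := functional_reflect T lL' T0 p.
  rewrite subrr subr0 -hl /lin /functional => H.
  transitivity (\int[mu]_(t in `[0, T]) - Llin b (f (T - t)) (- - g (T - t))).
    apply: eq_Rintegral => t _; rewrite opprK /Llin /dotv -sumrN.
    by apply: eq_bigr => i _; rewrite !mxE mulrN.
  rewrite H -mulN1r -RintegralZl//; last exact: lL.
  by apply: eq_Rintegral => t _; rewrite mulN1r.
have enE : energy V b 0 T (fun t => f (T - t)) (fun t => - g (T - t)) =
    energy V b 0 T f g.
  rewrite /energy; congr (_ * _).
  have := functional_reflect T lE T0 p; rewrite subrr subr0 => <-.
  apply: eq_Rintegral => t _; rewrite /Len; congr (_ + _).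
  by rewrite /sqn /dotv; apply: eq_bigr => i _; rewrite !mxE; ring.
exists (fun t => f (T - t)), (fun t => - g (T - t)); split => //.
- by rewrite subr0.
- by rewrite subrr.
move: ha; rewrite (act_energy C2V C1b orth T0 p) (act_energy C2V C1b orth T0 p').
by rewrite enE linE hl subrr subr0 a0 aT; lra.
Qed.

(** The work of [b] along the straight segment; being a line integral, it is the same whatever time
    the segment takes. *)
Definition edge x y := \int[mu]_(t in `[0, 1]) dotv (b (x + t *: (y - x))) (y - x).

Lemma prim_segment x y : prim 0 1 (fun t : R => x + t *: (y - x)) (fun=> y - x).
Proof. exact: prim_line. Qed.

Lemma segment_norm x y (t r : R) : 0 <= t <= 1 -> `|x| <= r -> `|y| <= r ->
  `|x + t *: (y - x)| <= r.
Proof.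
move=> /andP[t0 t1] xr yr.
have -> : x + t *: (y - x) = (1 - t) *: x + t *: y.
  by rewrite scalerBr scalerBl scale1r addrA addrAC.
apply: le_trans (ler_normD _ _) _; rewrite !normrZ !ger0_norm ?subr_ge0//.
have : (1 - t) * `|x| <= (1 - t) * r by apply: ler_wpM2l => //; rewrite subr_ge0.
have : t * `|y| <= t * r by exact: ler_wpM2l.
lra.
Qed.

Lemma reach_segment (r s : R) : 0 < s -> exists K, forall x y,
  `|x| <= r -> `|y| <= r -> reach x y s (edge x y) K.
Proof.
move=> s0.
have cc i : continuous (fun x => cfield V b x 0 i).
  have -> : (fun x => cfield V b x 0 i) =
      (fun x => - 2^-1 * partial V i x + b x 0 i).
    by apply/funext => x; rewrite !mxE mulNr.
  move=> x; apply: (@continuousD _ _ _ (fun x => - 2^-1 * partial V i x)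
    (fun x => b x 0 i)); last exact: (C1_continuous (C1b i)).
  apply: (@continuousM _ _ (cst (- 2^-1)) (partial V i)); first exact: cst_continuous.
  exact: C2V.1.2.
have [C HC] := choice (fun i => continuous_bounded_rV r (cc i)).
(* On the ball of radius [r], [2 * r / s] bounds a coordinate of the velocity and [C i] the same
   coordinate of [cfield V b]. *)
pose k i := 2 * r / s + C i.
exists (2^-1 * ((\sum_i k i ^+ 2) * s)) => x y xr yr.
have r0 : 0 <= r by exact: le_trans xr.
pose v := s^-1 *: (y - x).
have sv : s *: v = y - x by rewrite scalerA divff ?gt_eqF// scale1r.
exists (fun t => x + t *: v), (fun=> v).
have p : prim 0 s (fun t => x + t *: v) (fun=> v) by exact: prim_line.
split => //.
- by rewrite scale0r addr0.
- by rewrite sv addrC subrK.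
- rewrite /edge -(Rintegral_scale s0); last first.
    exact: (lagrangian_lin C1b ler01 (prim_segment x y)).
  apply: eq_Rintegral => t _; rewrite /Llin /v scalerA.
  by rewrite /dotv mulr_sumr; apply: eq_bigr => i _; rewrite !mxE; ring.
- rewrite /act ler_pM2l ?invr_gt0// /functional.
  apply: (@le_trans _ _ (\int[mu]_(t in `[0, s]) (\sum_i k i ^+ 2))).
    apply: le_Rintegral => //.
    + exact: (lagrangian_act C2V C1b (ltW s0) p).
    + exact: sqint_integrable (sqint_cst _ _ _).
    + move=> t /=; rewrite in_itv/= => /andP[t0 ts].
      have pr : `|x + t *: v| <= r.
        rewrite /v scalerA; apply: segment_norm => //.
        by rewrite divr_ge0 ?(ltW s0)//= ler_pdivrMr// mul1r.
      rewrite /Lact /sqn /dotv; apply: ler_sum => i _.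
      have ki : `|(v - cfield V b (x + t *: v)) 0 i| <= k i.
        have -> (u w : vec) : (u - w) 0 i = u 0 i - w 0 i by rewrite !mxE.
        rewrite /k; apply: le_trans (ler_normB _ _) _; apply: lerD.
          apply: le_trans (coord_le_mx_norm v i) _.
          rewrite /v normrZ gtr0_norm ?invr_gt0// mulrC ler_pM2r ?invr_gt0//.
          apply: le_trans (ler_normB _ _) _; lra.
        by have [_ ->] := HC i.
      rewrite -expr2 -real_normK ?num_real// lerXn2r ?nnegrE//.
      exact: le_trans (normr_ge0 _) ki.
  rewrite Rintegral_cst//.
  have := lebesgue_measure_itv `[0, s]; rewrite /= lte_fin s0 => -> /=.
  by rewrite subr0.
Qed.

Lemma edge_bound (r : R) : exists M, 0 <= M /\ forall x y, `|x| <= r ->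
  `|y| <= r -> `|edge x y| <= M.
Proof.
have [B HB] := bb.
have [r0|r0] := leP 0 r; last first.
  by exists 0; split => // x y xr; have := le_lt_trans xr r0; rewrite normr_lt0.
have B0 : 0 <= B by apply: le_trans (HB 0); exact: sqrtr_ge0.
exists (\sum_(i < n) B * (2 * r)); split.
  by apply: sumr_ge0 => i _; rewrite mulr_ge0// mulr_ge0.
move=> x y xr yr; rewrite /edge.
have iL := lagrangian_lin C1b ler01 (prim_segment x y).
apply: le_trans (le_normr_Rintegral _ iL) _ => //.
apply: (@le_trans _ _ (\int[mu]_(t in `[0, 1]) (\sum_(i < n) B * (2 * r)))).
  apply: le_Rintegral => //.
  - exact: integrable_norm iL.
  - exact: sqint_integrable (sqint_cst _ _ _).
  - move=> t _; rewrite /dotv; apply: le_trans (ler_norm_sum _ _ _) _.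
    apply: ler_sum => i _; rewrite normrM; apply: ler_pM => //.
      exact: le_trans (coord_le_enorm _ i) (HB _).
    apply: le_trans (coord_le_mx_norm _ i) _.
    apply: le_trans (ler_normB _ _) _; lra.
rewrite Rintegral_cst//.
have := lebesgue_measure_itv `[0 : R, 1]; rewrite /= lte_fin ltr01 => -> /=.
by rewrite subr0 mulr1.
Qed.

End Reach.

Lemma continuous_Rsum {R : realType} (I : Type) (s : seq I) (f : I -> R -> R) :
  (forall i, continuous (f i)) -> continuous (fun t => \sum_(i <- s) f i t).
Proof.
move=> cf; elim: s => [|i s ih].
  have -> : (fun t : R => \sum_(i <- [::]) f i t) = cst 0.
    by apply/funext => t; rewrite big_nil.
  by move=> x; exact: cst_continuous.
have -> : (fun t : R => \sum_(j <- i :: s) f j t) =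
    (fun t => f i t + \sum_(j <- s) f j t).
  by apply/funext => t; rewrite big_cons.
by move=> x; apply: cvgD; [exact: cf|exact: ih].
Qed.

(** * Circulation of a field that is not a gradient *)

Section Loops.
Context {R : realType} {n : nat}.
Local Notation mu := (@lebesgue_measure R).
Local Notation vec := 'rV[R]_n.
Variable b : vec -> vec.
Hypotheses (C1b : C1field b) (bb : bounded_field b).
Hypothesis ngrad : ~ gradient_field b.
Implicit Types (x y z u w : vec) (T l E : R).

Lemma edgexx x : edge b x x = 0.
Proof.
rewrite /edge (@eq_Rintegral _ _ _ _ _ (fun=> 0)).
  by rewrite Rintegral_cst// mul0r.
by move=> t _; rewrite subrr /dotv big1// => i _; rewrite mxE mulr0.
Qed.

Lemma integrable_edge x y :
  mu.-integrable `[0, 1] (EFin \o (fun t => dotv (b (x + t *: (y - x))) (y - x))).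
Proof. exact: (lagrangian_lin C1b ler01 (prim_segment x y)). Qed.

(** The quotient is the mean over the segment of coordinate [i] of [b], which is continuous at
    [x]. *)
Lemma edge_derivative x (i : 'I_n) :
  h^-1 * edge b x (x + h *: evec R i) @[h --> 0^'] --> b x 0 i.
Proof.
apply/cvgrPdist_le => e e0.
have /cvgrPdist_le/(_ _ e0) := @C1_continuous _ _ _ (C1b i) x.
move=> /nbhs_ballP[d /= d0 Hd].
near=> h.
have h0 : h != 0 by near: h; exact: nbhs_dnbhs_neq.
have hd : `|h| < d by near: h; exact: dnbhs0_lt.
have iE := integrable_edge x (x + h *: evec R i).
have E : h^-1 * edge b x (x + h *: evec R i) =
    \int[mu]_(t in `[0, 1]) (h^-1 * dotv (b (x + t *: (x + h *: evec R i - x)))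
      (x + h *: evec R i - x)).
  by rewrite RintegralZl.
have E1 : b x 0 i = \int[mu]_(t in `[0, 1]) b x 0 i.
  rewrite Rintegral_cst//.
  have := lebesgue_measure_itv `[0 : R, 1]; rewrite /= lte_fin ltr01 => -> /=.
  by rewrite subr0 mulr1.
have ic : mu.-integrable `[0, 1] (EFin \o (fun=> b x 0 i)).
  exact: sqint_integrable (sqint_cst _ _ _).
have iZ := integrableZ h^-1 (measurable_itv _) iE.
rewrite E E1 -RintegralB//.
have iB := integrableRB (measurable_itv _) ic iZ.
apply: le_trans (le_normr_Rintegral _ iB) _ => //.
have -> : e = \int[mu]_(t in `[0, 1]) e.
  rewrite Rintegral_cst//.
  have := lebesgue_measure_itv `[0 : R, 1]; rewrite /= lte_fin ltr01 => -> /=.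
  by rewrite subr0 mulr1.
apply: le_Rintegral => //; first exact: integrable_norm iB.
  exact: sqint_integrable (sqint_cst _ _ _).
move=> t /=; rewrite in_itv/= => /andP[t0 t1].
have -> : x + h *: evec R i - x = h *: evec R i by rewrite addrC addKr.
have -> : h^-1 * dotv (b (x + t *: (h *: evec R i))) (h *: evec R i) =
    b (x + t *: (h *: evec R i)) 0 i.
  rewrite /dotv (bigD1 i)//= big1 ?addr0.
    by rewrite !mxE !eqxx/= mulr1 mulrCA mulVf// mulr1.
  by move=> j ji; rewrite !mxE eqxx (negbTE ji)/= !mulr0.
apply: Hd; split => // i0 j; rewrite /ball/= !mxE opprD addNKr normrN ord1 eqxx/=.
rewrite normrM ger0_norm// normrM.
apply: le_lt_trans hd; rewrite -[leRHS]mul1r.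
apply: ler_pM; rewrite ?mulr_ge0//.
rewrite -[leRHS]mulr1; apply: ler_wpM2l => //.
by case: (_ == _) => /=; rewrite ?normr1 ?normr0.
Unshelve. all: by end_near. Qed.

(** If all triangles at 0 had zero circulation, [edge b x y] would be the increment of [edge b 0]
    from [x] to [y], and [edge_derivative] would make [edge b 0] a potential of [b]. *)
Lemma exists_triangle : exists x y,
  edge b 0 x + edge b x y + edge b y 0 != 0.
Proof.
apply: contrapT => H; apply: ngrad; exists (edge b 0) => x.
have tri y z : edge b 0 y + edge b y z + edge b z 0 = 0.
  by apply: contrapT => /eqP N; apply: H; exists y, z.
have opp y : edge b y 0 = - edge b 0 y.
  by have := tri y y; rewrite edgexx; lra.
have inc y z : edge b 0 z - edge b 0 y = edge b y z.
  by have := tri y z; rewrite opp; lra.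
have cv i : h^-1 *: ((edge b 0 \o shift x) (h *: evec R i) - edge b 0 x)
    @[h --> 0^'] --> b x 0 i.
  rewrite (_ : (fun _ => _) = fun h => h^-1 * edge b x (x + h *: evec R i)).
    exact: edge_derivative.
  by apply/funext => h /=; rewrite inc addrC.
split=> [i|]; first by apply/cvg_ex; exists (b x 0 i); exact: cv.
by apply/rowP => i; rewrite mxE; apply/cvg_lim => //; exact: cv.
Qed.

Lemma edge_scaled_continuous u w :
  {within `[0, 1], continuous (fun k : R => edge b (k *: u) (k *: w))}.
Proof.
pose f (k t : R) := dotv (b (k *: (u + t *: (w - u)))) (w - u).
have E k : edge b (k *: u) (k *: w) = k * \int[mu]_(t in `[0, 1]) f k t.
  rewrite -RintegralZl//; last first.
    have := @integrable_dotv R n `[0, 1]%classic (fun t => b (k *: (u + t *: (w - u))))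
      (fun=> w - u); apply => //.
      have p : prim 0 1 (fun t => k *: u + t *: (k *: (w - u))) (fun=> k *: (w - u)).
        exact: prim_line.
      move=> i; apply: eq_sqint (sqint_field_prim C1b i ler01 p) => // t _.
      by rewrite [k *: (u + _)]scalerDr !scalerA [t * k]mulrC.
    by move=> i; exact: sqint_cst.
  apply: eq_Rintegral => t _; rewrite /f /dotv mulr_sumr; apply: eq_bigr => i _.
  rewrite -scalerBr [k *: (u + _)]scalerDr !scalerA [t * k]mulrC.
  by rewrite [(k *: (w - u)) 0 i]mxE; ring.
have cf t : continuous (f ^~ t).
  apply: continuous_Rsum => i k.
  apply: cvgM; last exact: cvg_cst.
  apply: (@continuous_comp _ _ _ (fun k : R => k *: (u + t *: (w - u))) (fun x => b x 0 i)).
    exact: scalel_continuous.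
  exact: (C1_continuous (C1b i)).
have [B HB] := bb.
have B0 : 0 <= B by apply: le_trans (HB 0); exact: sqrtr_ge0.
have int_f k : mu.-integrable `[0, 1] (EFin \o f k).
  have := @integrable_dotv R n `[0, 1]%classic (fun t => b (k *: (u + t *: (w - u))))
    (fun=> w - u); apply => //.
    have p : prim 0 1 (fun t => k *: u + t *: (k *: (w - u))) (fun=> k *: (w - u)).
      exact: prim_line.
    move=> i; apply: eq_sqint (sqint_field_prim C1b i ler01 p) => // t _.
    by rewrite [k *: (u + _)]scalerDr !scalerA [t * k]mulrC.
  by move=> i; exact: sqint_cst.
(* An open interval around [[0, 1]], so that the endpoints are covered. Bounding [b] by [B] gives a
   dominating function that is constant in both variables. *)
have cF : {in (`]-1, 2[%classic : set R), continuous (fun k => \int[mu]_(t in `[0, 1]) f k t)}.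
  apply: (@continuity_under_integral _ _ _ mu f `[0, 1]%classic _ (-1) 2
    _ _ (fun=> \sum_(i < n) B * `|(w - u) 0 i|)) => //.
  - by apply: aeW => t _ k _; exact: cf.
  - exact: sqint_integrable (sqint_cst _ _ _).
  - move=> k _; apply: aeW => t _; rewrite /f /dotv.
    apply: le_trans (ler_norm_sum _ _ _) _; apply: ler_sum => i _.
    by rewrite normrM ler_wpM2r// (le_trans (coord_le_enorm _ i)).
rewrite (_ : (fun k => _) = fun k => k * \int[mu]_(t in `[0, 1]) f k t); last first.
  by apply/funext => k; exact: E.
apply: continuous_in_subspaceT => k; rewrite inE/= in_itv/= => /andP[k0 k1].
apply: cvgM; first exact: cvg_id.
by apply: cF; rewrite inE/= in_itv/=; apply/andP; split; lra.
Qed.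

End Loops.

Lemma norm_le_minmax0 (R : realDomainType) (f l : R) : `|l| <= `|f| ->
  Num.min 0 f <= l <= Num.max 0 f \/ Num.min 0 f <= - l <= Num.max 0 f.
Proof.
rewrite ler_norml; have [f0|f0] := leP 0 f.
  rewrite ger0_norm// => /andP[? ?].
  by have [?|?] := leP 0 l; [left|right]; apply/andP; split; lra.
rewrite ltr0_norm// => /andP[? ?].
by have [?|?] := leP 0 l; [right|left]; apply/andP; split; lra.
Qed.

(** * Loops at the origin with prescribed work *)

Section LoopRate.
Context {R : realType} {n : nat}.
Local Notation vec := 'rV[R]_n.
Variables (V : vec -> R) (b : vec -> vec).
Hypotheses (C2V : C2 V) (C1b : C1field b).
Hypothesis orth : forall x, dotv (grad V x) (b x) = 0.
Hypothesis bb : bounded_field b.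
Hypothesis ngrad : ~ gradient_field b.
Implicit Types (x y z u w : vec) (T l E : R).

Local Notation reach := (reach V b).

(** Shrinking the triangle to 0 moves its circulation continuously from [F 1] to 0, and every value
    in between is attained; reversal gives the opposite signs. Only the cost [K] depends on the
    duration [s], not the range [kappa]. *)
Lemma exists_small_loops : exists2 kappa : R, 0 < kappa & forall s, 0 < s ->
  exists K, forall l, `|l| <= kappa -> reach 0 0 s l K.
Proof.
have [x [y k0]] := exists_triangle C1b ngrad.
pose F (k : R) := edge b (k *: 0) (k *: x) + edge b (k *: x) (k *: y) +
  edge b (k *: y) (k *: 0).
have F1 : F 1 = edge b 0 x + edge b x y + edge b y 0.
  by rewrite /F !scale1r.
have F0 : F 0 = 0 by rewrite /F !scale0r edgexx !addr0.
have cF : {within `[0, 1], continuous F}.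
  move=> t; apply: cvgD; last exact: edge_scaled_continuous.
  by apply: cvgD; exact: edge_scaled_continuous.
exists `|F 1|; first by rewrite normr_gt0 F1.
move=> s s0; have s3 : 0 < s / 3 by rewrite divr_gt0.
pose r := Num.max `|x| `|y|.
have r0 : 0 <= r by rewrite le_max normr_ge0.
have [K HK] := reach_segment C2V C1b r s3.
have pos l : Num.min (F 0) (F 1) <= l <= Num.max (F 0) (F 1) ->
    reach 0 0 s l (K + K + K).
  move=> lF; have [k kI <-] := IVT (@ler01 R) cF lF.
  move: kI; rewrite in_itv/= => /andP[k0' k1].
  have kr (z : vec) : `|z| <= r -> `|k *: z| <= r.
    move=> zr; rewrite normrZ ger0_norm//; apply: le_trans zr.
    by rewrite ler_piMl.
  have kx : `|k *: x| <= r by apply: kr; rewrite le_max lexx.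
  have ky : `|k *: y| <= r by apply: kr; rewrite le_max lexx orbT.
  have kz : `|k *: (0 : vec)| <= r by rewrite scaler0 normr0.
  have h1 := HK _ _ kz kx; have h2 := HK _ _ kx ky; have h3 := HK _ _ ky kz.
  have s30 : 0 <= s / 3 by exact: ltW.
  have := reach_cat C2V C1b (addr_ge0 s30 s30) s30 (reach_cat C2V C1b s30 s30 h1 h2) h3.
  rewrite scaler0 (_ : s / 3 + s / 3 + s / 3 = s); last by field.
  by rewrite /F scaler0.
(* The last summand is the price of reversing a loop, from [reach_loopN]. *)
exists (K + K + K + 2 * `|F 1|) => l lF.
have := norm_le_minmax0 lF; rewrite -F0 => -[/pos h|/pos h].
  by apply: reach_le h; rewrite lerDl mulr_ge0.
have := reach_loopN C2V C1b orth (ltW s0) h; rewrite opprK; apply: reach_le.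
have := lerNnormlW lF; clear; lra.
Qed.

(** Time 1 holds [N] loops of duration [1 / N], whose work can reach [N * kappa], at least [2 * L].
    A longer time [T] is cut into laps with duration between 1 and 2, each treated in this way. *)
Lemma loop_rate (L : R) : 0 <= L -> exists K, 0 <= K /\ forall T l, 1 <= T ->
  `|l| <= L * T -> reach 0 0 T l (K * T).
Proof.
move=> L0; have [kappa k0 Hk] := exists_small_loops.
pose N := (Num.truncn (2 * L / kappa)).+1.
have NL : 2 * L <= N%:R * kappa.
  by rewrite -ler_pdivrMr// ltW// truncnS_gt.
have N0 : 0 < N%:R :> R by rewrite ltr0n.
have Ni : 0 < N%:R^-1 :> R by rewrite invr_gt0.
have [K1 HK1] := Hk _ Ni.
have K10 : 0 <= K1.
  by apply: (reach_ge0 (HK1 0 _)); rewrite normr0 ltW.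
pose c0 := 2^-1 * sqn (cfield V b 0).
have c00 : 0 <= c0 by rewrite mulr_ge0// sqn_ge0.
pose K2 := N%:R * K1 + c0.
have short T l : 1 <= T <= 2 -> `|l| <= 2 * L -> reach 0 0 T l K2.
  move=> /andP[T1 T2] lL.
  have lN : `|l / N%:R| <= kappa.
    rewrite normrM (gtr0_norm Ni) ler_pdivrMr// mulrC.
    exact: le_trans NL.
  have := reach_iter C2V C1b N (ltW Ni) (HK1 _ lN).
  rewrite divff ?gt_eqF// mulrCA divff ?gt_eqF// mulr1 => h1.
  have T10 : 0 <= T - 1 by rewrite subr_ge0.
  have := reach_cat C2V C1b ler01 T10 h1 (reach_stay V b 0 T10).
  rewrite addrC subrK addr0; apply: reach_le; rewrite /K2 lerD2l mulrA.
  by rewrite -/c0 ler_piMr//; lra.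
have K20 : 0 <= K2 by rewrite addr_ge0// mulr_ge0// ltW.
exists K2; split => // T l T1 lT.
have T0 : 0 <= T by lra.
(* [m] laps of duration [T / m]; each has work at most [L * T / m], which is at most [2 * L], and
   [m <= T] makes the total cost linear in [T]. *)
pose m := Num.truncn T.
have m0 : (0 < m)%N by rewrite truncn_gt0.
have [mT Tm] : m%:R <= T /\ T < m%:R + 1.
  by have /andP[h1 h2] := truncn_itv T0; rewrite -natr1 in h2.
have m1 : 1 <= m%:R :> R by rewrite ler1n.
have mp : 0 < m%:R :> R by lra.
have h1 : 1 <= T / m%:R <= 2.
  by rewrite ler_pdivlMr// mul1r mT/= ler_pdivrMr//; lra.
have h2 : `|l / m%:R| <= 2 * L.
  rewrite normrM normfV (gtr0_norm mp) ler_pdivrMr//.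
  apply: le_trans lT _; rewrite mulrAC mulrC ler_wpM2r//; lra.
have hT : 0 <= T / m%:R by case/andP: h1; lra.
have := reach_iter C2V C1b m hT (short _ _ h1 h2).
rewrite mulrCA divff ?gt_eqF// mulr1 mulrCA divff ?gt_eqF// mulr1.
by apply: reach_le; rewrite mulrC; apply: ler_wpM2l.
Qed.

End LoopRate.

(** * The rate function *)

Section Coercivity.
Context {R : realType} {n : nat}.
Local Notation vec := 'rV[R]_n.
Variables (V : vec -> R).
Hypotheses (C1V : C1 V) (cV : coercive_growth V).

Lemma dotvZr (k : R) (u v : vec) : dotv u (k *: v) = k * dotv u v.
Proof. by rewrite /dotv mulr_sumr; apply: eq_bigr => i _; rewrite mxE; ring. Qed.

Lemma enormZ (k : R) (u : vec) : enorm (k *: u) = `|k| * enorm u.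
Proof.
rewrite -sqrtr_sqr /enorm -sqrtrM ?sqr_ge0//; congr Num.sqrt.
by rewrite /dotv mulr_sumr; apply: eq_bigr => i _; rewrite mxE; ring.
Qed.

(** Where the squared gradient is at most [G], the quotient in [coercive_growth] is at most [n]
    times the root of [G], estimating coordinate by coordinate; coercivity forbids this far away. *)
Lemma grad_sublevel_bounded (G : R) : exists r, forall x, sqn (grad V x) <= G -> `|x| <= r.
Proof.
have M0 : 0 <= \sum_(i < n) Num.sqrt G by apply: sumr_ge0 => i _; exact: sqrtr_ge0.
have [r Hr] := cV (\sum_(i < n) Num.sqrt G).
exists r => x xG; apply: le_trans (mx_norm_le_enorm x) _.
rewrite leNgt; apply/negP => /Hr; apply/negP; rewrite -leNgt.
(* For a vector of norm 0 the quotient is 0, by the convention on the inverse of 0. *)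
have [x0|x0] := eqVneq (enorm x) 0; first by rewrite x0 invr0 mulr0.
have xp : 0 < enorm x by rewrite lt_def x0 sqrtr_ge0.
rewrite ler_pdivrMr// /dotv mulr_suml; apply: ler_sum => i _.
apply: le_trans (ler_norm _) _; rewrite normrM; apply: ler_pM => //.
  apply: le_trans (coord_le_enorm _ i) _; rewrite /enorm ler_sqrt//.
  exact: le_trans (sqn_ge0 _) xG.
exact: coord_le_enorm.
Qed.

(** Outside a ball [V] increases along rays, so [V x] is at least the value of [V] at the radial
    projection [k *: x] on the sphere, where continuity bounds it. *)
Lemma potential_bounded_below : exists m, forall x, m <= V x.
Proof.
have [r0 Hr] := cV 0.
pose r := `|r0| + 1.
have rp : 0 < r by rewrite ltr_wpDl.
have r0r : r0 < r by rewrite /r; have := ler_norm r0; lra.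
have [C [C0 HC]] := continuous_bounded_rV r (C1_continuous C1V).
have in_ball x : `|x| <= r -> - C <= V x.
  by move=> /HC; rewrite ler_norml => /andP[].
exists (- C) => x; have [xr|rx] := leP (enorm x) r.
  by apply: in_ball; exact: le_trans (mx_norm_le_enorm x) xr.
have xp : 0 < enorm x by exact: lt_trans rx.
pose k := r / enorm x.
have k0 : 0 < k by rewrite divr_gt0.
have k1 : k < 1 by rewrite ltr_pdivrMr// mul1r.
have kx : enorm (k *: x) = r by rewrite enormZ gtr0_norm// divfK// gt_eqF.
apply: (@le_trans _ _ (V (k *: x))).
  by apply: in_ball; rewrite -kx mx_norm_le_enorm.
pose v := (1 - k) *: x.
have p : prim 0 1 (fun t : R => k *: x + t *: v) (fun=> v) by exact: prim_line.
have kv : k *: x + v = x by rewrite /v -scalerDl addrC subrK scale1r.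
have := chain_rule ler01 C1V p; rewrite scale0r addr0 scale1r kv => e.
rewrite -subr_ge0 e; apply: Rintegral_ge0 => t; rewrite /= in_itv/= => /andP[t0 t1].
have -> : k *: x + t *: v = (k + t * (1 - k)) *: x by rewrite scalerA scalerDl.
set c := k + t * (1 - k).
have kc : k <= c by rewrite lerDl mulr_ge0// subr_ge0 ltW.
have cp : 0 < c by lra.
have nc : r <= enorm (c *: x) by rewrite -kx !enormZ !gtr0_norm// ler_pM2r.
have := Hr (c *: x) (lt_le_trans r0r nc).
rewrite pmulr_lgt0 ?invr_gt0; last by lra.
by rewrite /v !dotvZr => /ltW; rewrite pmulr_rge0// => h; rewrite mulr_ge0// subr_ge0 ltW.
Qed.

End Coercivity.

(** The loop at [y] goes to [x] in time 1, makes [m] laps of the given loop, goes to 0 in time 1,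
    corrects its work there during [tau] and returns to [y] in time 1. All but the laps costs at
    most the constant [C], which [eta * T'] absorbs. *)
Lemma upper_rate (R : realType) (n : nat) (V : 'rV[R]_n -> R)
    (b : 'rV[R]_n -> 'rV[R]_n) (q : R) (x : 'rV[R]_n) (T E r eta : R) :
  C2 V -> C1field b -> (forall x, dotv (grad V x) (b x) = 0) ->
  bounded_field b -> ~ gradient_field b -> 0 < T -> 0 < eta ->
  reach V b x x T (q * T / 2) E -> exists T0, forall T' y, T0 <= T' -> `|y| <= r ->
    reach V b y y T' (q * T' / 2) ((E / T + eta) * T').
Proof.
move=> C2V C1b orth bb ngrad T0 eta0 rx.
pose r' := Num.max r `|x|.
have r'0 : 0 <= r' by rewrite le_max normr_ge0 orbT.
have [K0 HK0] := reach_segment C2V C1b r' (@ltr01 R).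
have [M [M0 HM]] := edge_bound C1b bb r'.
(* The correction has to supply [q * (3 + tau) / 2] minus the work of three segments; this rate
   suffices because [tau >= 1]. *)
have L0 : 0 <= 2 * `|q| + 3 * M by rewrite addr_ge0// mulr_ge0.
have [K [K_ge0 HK]] := loop_rate C2V C1b orth bb ngrad L0.
have E0 := reach_ge0 rx.
pose C := 3 * K0 + K * (1 + T).
exists (4 + `|C| / eta) => T' y T'0 yr.
have Ce : 0 <= `|C| / eta by rewrite divr_ge0// ltW.
have CT : C <= eta * T'.
  apply: le_trans (ler_norm _) _; rewrite mulrC -ler_pdivrMr//; lra.
(* Time 3 is reserved for the segments and at least 1 for the correction, which leaves [tau] between
   1 and [1 + T]. *)
have T4 : 0 <= (T' - 4) / T by apply: divr_ge0; [lra|exact: ltW].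
pose m := Num.truncn ((T' - 4) / T).
have /andP[m1 m2] := truncn_itv T4; rewrite -/m in m1 m2.
rewrite ler_pdivlMr// in m1; rewrite -[m.+1%:R]natr1 ltr_pdivrMr// mulrDl mul1r in m2.
pose tau := T' - 3 - m%:R * T.
have tau1 : 1 <= tau by rewrite /tau; lra.
have tau2 : tau <= 1 + T by rewrite /tau; lra.
have xr' : `|x| <= r' by rewrite le_max lexx orbT.
have yr' : `|y| <= r' by rewrite le_max yr.
have zr' : `|0 : 'rV[R]_n| <= r' by rewrite normr0.
pose l := q * T' / 2 - (edge b y x + edge b x 0 + edge b 0 y) - m%:R * (q * T / 2).
have lE : l = q * (3 + tau) / 2 - (edge b y x + edge b x 0 + edge b 0 y).
  by rewrite /l /tau; field.
have lb : `|l| <= (2 * `|q| + 3 * M) * tau.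
  rewrite lE; apply: le_trans (ler_normB _ _) _.
  have h1 : `|q * (3 + tau) / 2| = `|q| * (3 + tau) / 2.
    have e1 : `|3 + tau| = 3 + tau by apply: ger0_norm; lra.
    have e2 : `|2^-1 : R| = 2^-1 by apply: ger0_norm.
    by rewrite !normrM e1 e2.
  have h2 : `|edge b y x + edge b x 0 + edge b 0 y| <= 3 * M.
    have := ler_normD (edge b y x + edge b x 0) (edge b 0 y).
    have := ler_normD (edge b y x) (edge b x 0).
    have := HM y x yr' xr'; have := HM x 0 xr' zr'; have := HM 0 y zr' yr'.
    by clear; lra.
  have q0 := normr_ge0 q.
  have h3 : `|q| * 1 <= `|q| * tau by apply: ler_wpM2l.
  have h4 : M * 1 <= M * tau by apply: ler_wpM2l.
  by rewrite h1; move: h2 h3 h4 tau1 M0; clear; lra.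
have tau0 : 0 <= tau by exact: le_trans tau1.
have mT0 : 0 <= m%:R * T by rewrite mulr_ge0// ltW.
have one0 : 0 <= 1 :> R by [].
have p1 := HK0 _ _ yr' xr'.
have p2 := reach_iter C2V C1b m (ltW T0) rx.
have p3 := HK0 _ _ xr' zr'.
have p4 := HK _ _ tau1 lb.
have p5 := HK0 _ _ zr' yr'.
have c1 := reach_cat C2V C1b one0 mT0 p1 p2.
have c2 := reach_cat C2V C1b (addr_ge0 one0 mT0) one0 c1 p3.
have c3 := reach_cat C2V C1b (addr_ge0 (addr_ge0 one0 mT0) one0) tau0 c2 p4.
have := reach_cat C2V C1b (addr_ge0 (addr_ge0 (addr_ge0 one0 mT0) one0) tau0) one0 c3 p5.
rewrite (_ : 1 + m%:R * T + 1 + tau + 1 = T'); last by rewrite /tau; ring.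
rewrite (_ : _ + edge b 0 y = q * T' / 2); last by rewrite /l; field.
apply: reach_le.
have h1 : K * tau <= K * (1 + T) by apply: ler_wpM2l.
have h2 : m%:R * E <= E / T * T'.
  rewrite [leRHS]mulrAC -mulrA [m%:R * E]mulrC; apply: ler_wpM2l => //.
  by rewrite ler_pdivlMr//; move: m1; clear; lra.
by rewrite mulrDl; move: CT h1 h2; rewrite /C; clear; lra.
Qed.

Section Rates.
Context {R : realType} {n : nat}.
Local Notation vec := 'rV[R]_n.
Variables (V : vec -> R) (b : vec -> vec).
Hypotheses (C2V : C2 V) (C1b : C1field b).
Hypothesis orth : forall x, dotv (grad V x) (b x) = 0.
Hypothesis bb : bounded_field b.
Hypothesis ngrad : ~ gradient_field b.
Implicit Types (x y z u w : vec) (T l E q : R).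

Local Notation reach := (reach V b).

Definition loop_rates x q : set R :=
  [set e | exists T E, [/\ 0 < T, reach x x T (q * T / 2) E & e = E / T]].

(** Loops are based at 0, where correcting loops are available; [rate_le_loop] and [rate_upper]
    carry the value over to other base points. *)
Definition rate q := inf (loop_rates 0 q).

Lemma loop_rates_neq0 q : loop_rates 0 q !=set0.
Proof.
have [K [_ HK]] := loop_rate C2V C1b orth bb ngrad (normr_ge0 (q / 2)).
exists (K * 1 / 1); exists 1, (K * 1); split => //.
by apply: HK => //; rewrite !mulr1.
Qed.

Lemma loop_rates_ge0 x q : lbound (loop_rates x q) 0.
Proof. by move=> _ [T [E [T0 /reach_ge0 E0 ->]]]; rewrite divr_ge0// ltW. Qed.

Lemma rate_ge0 q : 0 <= rate q.
Proof. by apply: lb_le_inf; [exact: loop_rates_neq0|exact: loop_rates_ge0]. Qed.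

Lemma rate_le q T E : 0 < T -> reach 0 0 T (q * T / 2) E -> rate q * T <= E.
Proof.
move=> T0 h; rewrite -ler_pdivlMr//; apply: ge_inf; first by exists 0; exact: loop_rates_ge0.
by exists T, E.
Qed.

End Rates.

(** * The lower bound *)

(** The choices are made in the order [th], [e], [d]: [th * T] is the duration of the correction,
    [e] the weight in Young's inequality, [d * T] the length of the window for the cut. In the
    application [K] is the rate of [loop_rate], [C] the energy rate, [B] bounds the square of [b],
    [a] is the absolute value of [q] and [s] its rate. *)
Lemma lower_rate_parameters (R : realFieldType) (eta K C B a s : R) :
  0 < eta -> 0 <= K -> 0 < C -> 0 <= B -> 0 <= a -> 0 <= s ->
  exists th e d, [/\ 0 < th, 0 < e & 0 < d < 1] /\
    [/\ K * th <= eta / 4, e * C = th / 4, B / (2 * e) * d <= th / 4,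
        a * d / 2 <= th / 4 & s * d <= eta / 4].
Proof.
move=> eta0 K0 C0 B0 a0 s0.
(* Division by [k + 1] and not by [k] covers [k = 0]. *)
have frac (u k : R) : 0 < u -> 0 <= k -> 0 < u / (k + 1) /\ k * (u / (k + 1)) <= u.
  move=> u0 k0; have k1 : 0 < k + 1 by rewrite ltr_wpDl.
  split; first exact: divr_gt0.
  by rewrite mulrA ler_pdivrMr// mulrDr mulr1 mulrC lerDl ltW.
have eta4 : 0 < eta / 4 by rewrite divr_gt0.
have [th0 Kth] := frac _ _ eta4 K0; move: (_ / _) th0 Kth => th th0 Kth.
have th4 : 0 < th / 4 by rewrite divr_gt0.
pose e := th / 4 / C.
have e0 : 0 < e by rewrite divr_gt0.
have Be : 0 <= B / (2 * e) by rewrite divr_ge0// mulr_ge0// ltW.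
have [d0 d1] := frac _ _ th4 Be; have [d0' d2] := frac _ _ th4 a0.
have [d0'' d3] := frac _ _ eta4 s0.
move: (_ / (B / (2 * e) + 1)) (_ / (a + 1)) (_ / (s + 1)) d0 d1 d0' d2 d0'' d3.
move=> x y z x0 hx y0 hy z0 hz.
pose d := Num.min 2^-1 (Num.min x (Num.min y z)).
have dx : d <= x by rewrite !ge_min lexx !orbT.
have dy : d <= y by rewrite !ge_min lexx !orbT.
have dz : d <= z by rewrite !ge_min lexx !orbT.
have d0 : 0 < d by rewrite !lt_min x0 y0 z0 invr_gt0 ltr0n.
exists th, e, d; split; split => //.
- by rewrite d0/=; apply: (@le_lt_trans _ _ 2^-1); [rewrite ge_min lexx|clear; lra].
- by rewrite /e divfK// gt_eqF.
- exact: le_trans (ler_wpM2l Be dx) hx.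
- have := le_trans (ler_wpM2l a0 dy) hy.
  have : 0 <= a * d by rewrite mulr_ge0// ltW.
  by clear; lra.
- exact: le_trans (ler_wpM2l s0 dz) hz.
Qed.

Section EnergyEstimates.
Context {R : realType} {n : nat}.
Local Notation mu := (@lebesgue_measure R).
Local Notation vec := 'rV[R]_n.
Variables (V : vec -> R) (b : vec -> vec).
Hypotheses (C2V : C2 V) (C1b : C1field b).
Implicit Types (phi g : R -> vec).

Let Rintegral_itv_cst (a d k : R) : a <= d -> \int[mu]_(t in `[a, d]) k = k * (d - a).
Proof.
move=> ad; rewrite Rintegral_cst//.
have := lebesgue_measure_itv `[a, d]; rewrite /= lte_fin => ->.
by case: ltgtP ad => // -> _; rewrite subrr mulr0.
Qed.

(** Otherwise the gradient term of [Len], integrated over this window of length [d * T], would alone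
    give an energy of at least [2 * C * T]. *)
Lemma exists_good_time T phi g (C d : R) : 0 < C -> 0 < d < 1 -> 0 < T ->
  prim 0 T phi g -> energy V b 0 T phi g <= C * T ->
  exists2 t, (1 - d) * T <= t <= T & sqn (grad V (phi t)) <= 16 * C / d.
Proof.
move=> C0 /andP[d0 d1] T0 p eC; apply: contrapT => H.
have big t : (1 - d) * T <= t <= T -> 16 * C / d <= sqn (grad V (phi t)).
  by move=> tI; rewrite leNgt; apply/negP => /ltW h; apply: H; exists t.
pose a := (1 - d) * T.
have a0 : 0 <= a by rewrite mulr_ge0 ?subr_ge0// ltW.
have aT : a <= T by rewrite /a -[leRHS]mul1r ler_pM2r//; lra.
have lE := lagrangian_energy C2V C1b.
have iE := lE _ _ _ _ (ltW T0) p.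
have aI : 0 <= a <= T by rewrite a0.
have : 4^-1 * (16 * C / d) * (T - a) <= functional (Len V b) 0 T phi g.
  rewrite (functional_split lE aI p) -[leLHS]add0r; apply: lerD.
    apply: Rintegral_ge0 => t _; rewrite /Len addr_ge0 ?sqn_ge0//.
    by rewrite addr_ge0 ?sqn_ge0// mulr_ge0// sqn_ge0.
  rewrite -Rintegral_itv_cst//; apply: le_Rintegral => //.
  - exact: sqint_integrable (sqint_cst _ _ _).
  - exact: lE aT (primS a0 (lexx _) p).
  - move=> t /=; rewrite in_itv/= => tI; rewrite /Len.
    have := big t tI; have := sqn_ge0 (g t); have := sqn_ge0 (b (phi t)).
    lra.
have -> : 4^-1 * (16 * C / d) * (T - a) = 4 * (C * T).
  by rewrite /a; field; rewrite gt_eqF.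
move: eC; rewrite /energy => eC h.
have CT : 0 < C * T by rewrite mulr_gt0.
lra.
Qed.

(** Young's inequality with weight [e]. The [b] term is paid only over the length [T - a], short in
    the application; the velocity term is a small multiple of the energy of the whole path. *)
Lemma lin_young T phi g (B e a : R) : 0 < e -> 0 <= a <= T ->
  (forall x, sqn (b x) <= B) -> prim 0 T phi g ->
  `|lin b a T phi g| <= B * (T - a) / (2 * e) + e * energy V b 0 T phi g.
Proof.
move=> e0 aT HB p; have /andP[a0 aT'] := aT.
have T0 : 0 <= T by exact: le_trans aT'.
have lE := lagrangian_energy C2V C1b.
have p' := primS a0 (lexx _) p.
have iL := lagrangian_lin C1b aT' p'.
have iE := lE _ _ _ _ aT' p'.
have e2 : 0 < (2 * e)^-1 by rewrite invr_gt0 mulr_gt0.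
rewrite /lin /functional; apply: le_trans (le_normr_Rintegral _ iL) _ => //.
have ic : mu.-integrable `[a, T] (EFin \o (fun=> B / (2 * e))).
  exact: sqint_integrable (sqint_cst _ _ _).
have iZ := integrableZ (e / 2) (measurable_itv _) iE.
apply: (@le_trans _ _ (\int[mu]_(t in `[a, T])
    (B / (2 * e) + e / 2 * Len V b (phi t) (g t)))).
  apply: le_Rintegral => //; first exact: integrable_norm iL.
    exact: integrableRD.
  move=> t _; rewrite /Llin.
  have h1 : sqn (b (phi t)) / (2 * e) <= B / (2 * e) by rewrite ler_pM2r.
  have h2 : e / 2 * sqn (g t) <= e / 2 * Len V b (phi t) (g t).
    rewrite ler_pM2l ?divr_gt0// /Len lerDl addr_ge0 ?sqn_ge0//.
    by rewrite mulr_ge0// sqn_ge0.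
  apply: le_trans (lerD h1 h2).
  rewrite /sqn /dotv mulr_suml mulr_sumr -big_split/=.
  apply: le_trans (ler_norm_sum _ _ _) _; apply: ler_sum => i _.
  set u := b (phi t) 0 i; set v := g t 0 i.
  have main : forall k : R, u * v * (2 * k) <= u ^+ 2 + k ^+ 2 * v ^+ 2 /\
      - (u * v) * (2 * k) <= u ^+ 2 + k ^+ 2 * v ^+ 2.
    by move=> k; split; have := sqr_ge0 (u - k * v); have := sqr_ge0 (u + k * v); nra.
  have [m1 m2] := main e.
  have -> : u * u / (2 * e) + e / 2 * (v * v) =
      (u ^+ 2 + e ^+ 2 * v ^+ 2) / (2 * e).
    by field; rewrite gt_eqF.
  have ep : 0 < 2 * e by rewrite mulr_gt0.
  rewrite ler_norml; apply/andP; split; last by rewrite ler_pdivlMr.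
  by rewrite lerNl ler_pdivlMr.
rewrite RintegralD// Rintegral_itv_cst// RintegralZl//.
rewrite mulrAC lerD2l /energy [leRHS]mulrA.
apply: ler_wpM2l; first by rewrite divr_ge0// ltW.
rewrite -/(functional (Len V b) a T phi g) (functional_split lE aT p) lerDr.
apply: Rintegral_ge0 => t _; rewrite /Len addr_ge0 ?sqn_ge0//.
by rewrite addr_ge0 ?sqn_ge0// mulr_ge0// sqn_ge0.
Qed.

End EnergyEstimates.

(** [act_energy] solved for the energy: [V] is bounded above on the ball of starting points and
    below everywhere, and the work is at most [a * T / 2]. The final [+ 1] in the constant makes it
    positive. *)
Lemma act_energy_bound (R : realType) (n : nat) (V : 'rV[R]_n -> R)
    (b : 'rV[R]_n -> 'rV[R]_n) (s r a : R) :
  C2 V -> coercive_growth V -> C1field b ->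
  (forall x, dotv (grad V x) (b x) = 0) -> 0 <= s -> 0 <= a -> exists2 C, 0 < C &
  forall T phi g q, 1 <= T -> `|phi 0| <= r -> q <= a -> prim 0 T phi g ->
    lin b 0 T phi g = q * T / 2 -> act V b 0 T phi g <= s * T ->
    energy V b 0 T phi g <= C * T.
Proof.
move=> C2V cV C1b orth s0 a0.
have [m Hm] := potential_bounded_below C2V.1 cV.
have [k [k0 Hk]] := continuous_bounded_rV r (C1_continuous C2V.1).
exists (s + 2^-1 * `|k - m| + a / 2 + 1).
  by have := normr_ge0 (k - m); clear -s0 a0; lra.
move=> T phi g q T1 /Hk + qa p lE aE.
rewrite ler_norml => /andP[_ Vx].
have T0 : 0 <= T by exact: le_trans T1.
have := act_energy C2V C1b orth T0 p; rewrite lE => ae.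
have my := Hm (phi T).
have qT : q * T <= a * T by apply: ler_wpM2r.
have h1 : `|k - m| <= `|k - m| * T by rewrite ler_peMr.
have h2 := ler_norm (k - m).
by move: Vx ae my qT h1 h2 T1 aE; clear; lra.
Qed.

(** Suppose the cost is too small. The path cut at a good time [t], joined to 0 by two segments of
    duration 1 and followed by a correcting loop of duration [tau = th * T], is a loop at 0 with
    rate [q] in time at least [(1 - d) * T]. Its cost then contradicts [rate_le]. *)
Lemma lower_rate (R : realType) (n : nat) (V : 'rV[R]_n -> R)
    (b : 'rV[R]_n -> 'rV[R]_n) (q r eta : R) :
  C2 V -> coercive_growth V -> C1field b ->
  (forall x, dotv (grad V x) (b x) = 0) -> bounded_field b -> ~ gradient_field b ->
  0 < eta -> exists T0 d0, 0 < d0 /\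
  forall T x y q' E, T0 <= T -> `|x| <= r -> `|q' - q| <= d0 ->
    reach V b x y T (q' * T / 2) E -> (rate V b q - eta) * T <= E.
Proof.
move=> C2V cV C1b orth bb ngrad eta0; have := rate_ge0 C2V C1b orth bb ngrad q.
move sE : (rate V b q) => s s0.
have [B0 HB0] := bb.
have HB x : sqn (b x) <= B0 ^+ 2.
  rewrite -sqr_enorm lerXn2r ?nnegrE ?sqrtr_ge0//.
  by apply: le_trans (HB0 x); exact: sqrtr_ge0.
have q0 := normr_ge0 q.
have [C C0 HC] := act_energy_bound r C2V cV C1b orth s0 (addr_ge0 q0 ler01).
have L0 : 0 <= 3 / 2 * `|q| + 2 by clear -q0; lra.
have [K [K0 HK]] := loop_rate C2V C1b orth bb ngrad L0.
have [th [e [d [[th0 e0 /andP[d0 d1]] [Kth eC d2 d3 d4]]]]] :=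
  lower_rate_parameters eta0 K0 C0 (sqr_ge0 B0) q0 s0.
have [rG HrG] := grad_sublevel_bounded cV (16 * C / d).
have [r2 rr2 rGr2] : exists2 k, r <= k & rG <= k.
  by exists (Num.max r rG); rewrite le_max lexx ?orbT.
have [K1 HK1] := reach_segment C2V C1b r2 (@ltr01 R).
have [M [M0 HM]] := edge_bound C1b bb r2.
(* The three summands give [1 <= T], room in [tau] for the work of both segments, and segment costs
   below [eta * T / 4]. The bound 1 on the deviation of [q'] serves the energy estimate, [th / 2]
   the correction of the work. *)
exists (1 + (1 + 2 * M) / th + `|8 * K1 / eta|), (Num.min 1 (th / 2)); split.
  by rewrite lt_min ltr01 divr_gt0.
move=> T x y q' E T0 xr; rewrite le_min => /andP[qq1 qq2] [phi [g [p h0 hT hl ha]]].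
have [T1 thT K1T] : [/\ 1 <= T, 1 + 2 * M <= th * T & 8 * K1 <= eta * T].
  have TM : 0 <= (1 + 2 * M) / th.
    by rewrite divr_ge0 ?(ltW th0)// addr_ge0// mulr_ge0.
  have TK := normr_ge0 (8 * K1 / eta).
  split; first by move: TM TK T0; clear; lra.
    by rewrite [leRHS]mulrC -ler_pdivrMr//; move: TK T0; clear; lra.
  rewrite [leRHS]mulrC -ler_pdivrMr//; apply: le_trans (ler_norm _) _.
  by move: TM T0; clear; lra.
have Tp : 0 < T by exact: lt_le_trans T1.
rewrite leNgt; apply/negP => Elt.
have eT : 0 < eta * T by rewrite mulr_gt0.
have EsT : E <= s * T by move: Elt eT; clear; lra.
have eJ : energy V b 0 T phi g <= C * T.
  apply: HC (p) hl _; rewrite ?h0//; last exact: le_trans EsT.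
  by have := ler_norm q; have := ler_norm (q' - q); move: qq1; clear; lra.
have dI : 0 < d < 1 by rewrite d0.
have [t /andP[t1 t2] tG] := exists_good_time C2V C1b C0 dI Tp p eJ.
have t0 : 0 <= t by apply: le_trans t1; rewrite mulr_ge0 ?subr_ge0// ltW.
have tI : 0 <= t <= T by rewrite t0.
have Tt : T - t <= d * T by move: t1; clear; lra.
have yr : `|phi t| <= r2 by apply: le_trans rGr2; exact: HrG.
have xr2 : `|x| <= r2 by exact: le_trans rr2.
have zr : `|0 : 'rV[R]_n| <= r2 by rewrite normr0; exact: le_trans xr2.
have act_t : act V b 0 t phi g <= E.
  apply: le_trans ha.
  rewrite /act ler_pM2l ?invr_gt0// (functional_split (lagrangian_act C2V C1b) tI p).
  by rewrite lerDl; apply: Rintegral_ge0 => u _; exact: sqn_ge0.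
have lin_t : lin b 0 t phi g = q' * T / 2 - lin b t T phi g.
  by rewrite -hl /lin (functional_split (lagrangian_lin C1b) tI p) addrK.
have lt_small : `|lin b t T phi g| <= th / 2 * T.
  apply: le_trans (lin_young C2V C1b e0 tI HB p) _.
  have h1 : e * energy V b 0 T phi g <= e * (C * T) by rewrite ler_pM2l.
  have h2 : B0 ^+ 2 / (2 * e) * (T - t) <= B0 ^+ 2 / (2 * e) * (d * T).
    by apply: ler_wpM2l => //; rewrite divr_ge0 ?sqr_ge0// mulr_ge0// ltW.
  have h3 : B0 ^+ 2 / (2 * e) * d * T <= th / 4 * T by rewrite ler_pM2r.
  rewrite [e * (C * T)]mulrA eC in h1; rewrite mulrAC.
  by move: h1 h2 h3; clear; lra.
have [tau tauE] : exists tau, tau = th * T by exists (th * T).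
have tau1 : 1 <= tau by rewrite tauE; move: thT M0; clear; lra.
have tau0 : 0 <= tau by exact: le_trans tau1.
have M2 : `|edge b 0 x + edge b (phi t) 0| <= 2 * M.
  apply: le_trans (ler_normD _ _) _; rewrite mulr_natl mulr2n.
  by apply: lerD; exact: HM.
(* The work still missing for a loop of total duration [2 + t + tau] with value exactly [q]. *)
pose l := q * (2 + t + tau) / 2 - edge b 0 x - lin b 0 t phi g - edge b (phi t) 0.
have lb : `|l| <= (3 / 2 * `|q| + 2) * tau.
  (* Apart from the first term and the two segments, the errors come from the cut, from [q'] against
     [q] and from the discarded tail; their bounds [th / 4], [th / 4] and [th / 2] times [T] add up
     to [tau]. *)
  have -> : l = q * (2 + tau) / 2 - q * (T - t) / 2 - (q' - q) * T / 2 +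
      (lin b t T phi g - (edge b 0 x + edge b (phi t) 0)).
    by rewrite /l lin_t; field.
  have a1 : `|q * (2 + tau) / 2| <= `|q| * (2 + tau) / 2.
    by rewrite !normrM (ger0_norm (addr_ge0 _ tau0))// (@ger0_norm _ 2^-1).
  have a2 : `|q * (T - t) / 2| <= th / 4 * T.
    rewrite !normrM (@ger0_norm _ (T - t)) ?subr_ge0// (@ger0_norm _ 2^-1)//.
    have : `|q| * (T - t) <= `|q| * (d * T) by exact: ler_wpM2l.
    have : `|q| * d / 2 * T <= th / 4 * T by rewrite ler_pM2r.
    by clear; lra.
  have a3 : `|(q' - q) * T / 2| <= th / 4 * T.
    rewrite !normrM (gtr0_norm Tp) (@ger0_norm _ 2^-1)//.
    have : `|q' - q| * T <= th / 2 * T by rewrite ler_pM2r.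
    by clear; lra.
  have a4 : `|q| * 1 <= `|q| * tau by exact: ler_wpM2l.
  apply: le_trans (ler_normD _ _) _.
  have := ler_normB (q * (2 + tau) / 2 - q * (T - t) / 2) ((q' - q) * T / 2).
  have := ler_normB (q * (2 + tau) / 2) (q * (T - t) / 2).
  have := ler_normB (lin b t T phi g) (edge b 0 x + edge b (phi t) 0).
  by move: a1 a2 a3 a4 lt_small M2 thT M0; rewrite tauE; clear; lra.
have rt : reach V b x (phi t) t (lin b 0 t phi g) E.
  by exists phi, g; split => //; exact: primS (lexx _) t2 p.
have one0 : 0 <= 1 :> R by [].
have c1 := reach_cat C2V C1b one0 t0 (HK1 _ _ zr xr2) rt.
have c2 := reach_cat C2V C1b (addr_ge0 one0 t0) one0 c1 (HK1 _ _ yr zr).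
have := reach_cat C2V C1b (addr_ge0 (addr_ge0 one0 t0) one0) tau0 c2 (HK _ _ tau1 lb).
rewrite (_ : 1 + t + 1 + tau = 2 + t + tau); last ring.
rewrite (_ : _ + l = q * (2 + t + tau) / 2); last by rewrite /l; ring.
have tt0 : 0 < 2 + t + tau by rewrite ltr_wpDr// ltr_wpDr.
move=> /(rate_le tt0); rewrite sE => hs.
have h1 : s * ((1 - d) * T) <= s * (2 + t + tau).
  by apply: ler_wpM2l => //; move: t1 tau0; clear; lra.
have h2 : s * d * T <= eta / 4 * T by rewrite ler_pM2r.
have h3 : K * tau <= eta / 4 * T by rewrite tauE mulrA ler_pM2r.
by move: Elt hs h1 h2 h3 eT K1T; clear; lra.
Qed.

(** * The value functions *)

Section Limits.
Context {R : realType}.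
Local Open Scope ereal_scope.

Lemma limn_einf_ge_near (u : (\bar R)^nat) (k : \bar R) :
  (\forall n \near \oo, k <= u n) -> k <= limn_einf u.
Proof.
move=> [N _ H]; rewrite limn_einf_lim; apply: lime_ge; first exact: is_cvg_einfs.
exists N => // n Nn; apply: le_ereal_inf_tmp => _ [m nm <-].
by apply: H; exact: leq_trans nm.
Qed.

Lemma limn_esup_le_near (u : (\bar R)^nat) (k : \bar R) :
  (\forall n \near \oo, u n <= k) -> limn_esup u <= k.
Proof.
move=> [N _ H]; rewrite limn_esup_lim; apply: lime_le; first exact: is_cvg_esups.
exists N => // n Nn; apply: ge_ereal_sup => _ [m nm <-].
by apply: H; exact: leq_trans nm.
Qed.

End Limits.

Section Values.
Context {R : realType} {n : nat}.
Local Notation vec := 'rV[R]_n.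
Variables (V : vec -> R) (b : vec -> vec).
Hypotheses (C2V : C2 V) (C1b : C1field b).
Hypothesis orth : forall x, dotv (grad V x) (b x) = 0.
Hypothesis bb : bounded_field b.
Hypothesis ngrad : ~ gradient_field b.
Implicit Types (x y z u w : vec) (T l E q : R).

Local Notation reach := (reach V b).
Local Notation rate := (rate V b).

Lemma STxy_le x y T q E : 0 < T -> reach x y T (q * T / 2) E ->
  (STxy V b x y T q <= E%:E)%E.
Proof.
move=> T0 [phi [g [p h0 hT hl ha]]]; have T0' := ltW T0.
apply: (@le_trans _ _ (IT V b x T phi)); last first.
  by rewrite -h0 (IT_act C2V C1b T0' p) lee_fin.
apply: ereal_inf_lbound; exists phi => //; split => //; split.
  by split => //; exact: prim_HT p.
by rewrite (LT_lin b T0' p) hl; field; rewrite gt_eqF.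
Qed.

Lemma IT_reach x T q phi : 0 < T -> AT b x T q phi -> exists2 E,
  IT V b x T phi = E%:E & reach x (phi T) T (q * T / 2) E.
Proof.
move=> T0 [[hT h0] hl]; have T0' := ltW T0.
have [g p] := HT_prim T0' hT.
exists (act V b 0 T phi g); first by rewrite -h0 (IT_act C2V C1b T0' p).
exists phi, g; split => //.
by rewrite -hl (LT_lin b T0' p); field; rewrite gt_eqF.
Qed.

Lemma STxy_ge x y T q (k : R) : 0 < T ->
  (forall E, reach x y T (q * T / 2) E -> k <= E) -> (k%:E <= STxy V b x y T q)%E.
Proof.
move=> T0 H; apply: le_ereal_inf_tmp => _ [phi [hA hy] <-].
have [E -> h] := IT_reach T0 hA; rewrite lee_fin; apply: H.
by rewrite -hy.
Qed.

Lemma STx_ge x T q (k : R) : 0 < T ->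
  (forall y E, reach x y T (q * T / 2) E -> k <= E) -> (k%:E <= STx V b x T q)%E.
Proof.
move=> T0 H; apply: le_ereal_inf_tmp => _ [phi hA <-].
by have [E -> h] := IT_reach T0 hA; rewrite lee_fin; exact: H h.
Qed.

Lemma STx_le_STxy x y T q : (STx V b x T q <= STxy V b x y T q)%E.
Proof.
by apply: ereal_inf_le_tmp => _ [phi [hA _] <-]; exists phi.
Qed.

(** [upper_rate] with [y = 0] converts a loop at [x] into loops at 0 of almost the same rate. *)
Lemma rate_le_loop x q T E : 0 < T -> reach x x T (q * T / 2) E ->
  rate q * T <= E.
Proof.
move=> T0 h; rewrite -ler_pdivlMr//; apply/ler_addgt0Pr => e e0.
have [T1 H] := upper_rate 0 C2V C1b orth bb ngrad T0 e0 h.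
pose T' := Num.max 1 T1.
have T'0 : 0 < T' by rewrite lt_max ltr01.
have := H T' 0; rewrite le_max lexx orbT normr0 lexx => /(_ isT isT) h'.
by have := rate_le T'0 h'; rewrite ler_pM2r.
Qed.

Lemma rate_upper q (r eta : R) : 0 < eta -> exists2 T0, 0 < T0 &
  forall T y, T0 <= T -> `|y| <= r -> reach y y T (q * T / 2) ((rate q + eta) * T).
Proof.
move=> e0; have e20 : 0 < eta / 2 by rewrite divr_gt0.
have hi : has_inf (loop_rates V b 0 q).
  by split; [exact: loop_rates_neq0|exists 0; exact: loop_rates_ge0].
have [_ [T [E [T0 h ->]]] lt] := inf_adherent e20 hi.
have [T1 H] := upper_rate r C2V C1b orth bb ngrad T0 e20 h.
exists (Num.max 1 T1); first by rewrite lt_max ltr01.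
move=> T' y; rewrite ge_max => /andP[T'1 T1T'] yr.
apply: reach_le (H T' y T1T' yr).
rewrite ler_pM2r; last by lra.
by move: lt; rewrite -/(rate q); lra.
Qed.

Lemma rate_convex q1 q2 t : 0 <= t <= 1 ->
  rate (t * q1 + (1 - t) * q2) <= t * rate q1 + (1 - t) * rate q2.
Proof.
move=> /andP[]; rewrite le_eqVlt => /predU1P[<- _|t0].
  by rewrite !mul0r !add0r subr0 !mul1r.
rewrite le_eqVlt => /predU1P[->|t1]; first by rewrite subrr !mul0r !addr0 !mul1r.
have t1' : 0 < 1 - t by rewrite subr_gt0.
apply/ler_addgt0Pr => e e0.
have [T1 T10 H1] := rate_upper q1 0 e0; have [T2 T20 H2] := rate_upper q2 0 e0.
(* Long enough for the shares [t * T] and [(1 - t) * T] to exceed [T1] and [T2]; this is why [t = 0]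
   and [t = 1] were split off. *)
pose T := T1 / t + T2 / (1 - t).
have h1 : 0 < T1 / t by rewrite divr_gt0.
have h2 : 0 < T2 / (1 - t) by rewrite divr_gt0.
have T0 : 0 < T by rewrite addr_gt0.
have tT : T1 <= t * T by rewrite mulrC -ler_pdivrMr// lerDl ltW.
have tT' : T2 <= (1 - t) * T by rewrite mulrC -ler_pdivrMr// lerDr ltW.
have z0 : `|0 : vec| <= 0 by rewrite normr0.
have tT0 : 0 <= t * T by rewrite ltW// mulr_gt0.
have tT0' : 0 <= (1 - t) * T by rewrite ltW// mulr_gt0.
have := reach_cat C2V C1b tT0 tT0' (H1 _ _ tT z0) (H2 _ _ tT' z0).
rewrite (_ : t * T + (1 - t) * T = T); last by ring.
rewrite (_ : q1 * (t * T) / 2 + q2 * ((1 - t) * T) / 2 =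
  (t * q1 + (1 - t) * q2) * T / 2); last by ring.
move=> /(rate_le T0); rewrite -ler_pdivlMr// => h; apply: le_trans h _.
rewrite ler_pdivrMr//; lra.
Qed.

Lemma rate_sym_le q : rate (- q) <= rate q + q.
Proof.
rewrite -lerBlDr; apply: lb_le_inf; first exact: loop_rates_neq0.
move=> _ [T [E [T0 h ->]]].
have := reach_loopN C2V C1b orth (ltW T0) h.
rewrite (_ : - (q * T / 2) = - q * T / 2); last by rewrite !mulNr.
move=> /(rate_le T0) h'; rewrite ler_pdivlMr//; lra.
Qed.

(** Reversal of loops gives one inequality; the other is the same inequality at [- q]. *)
Lemma rate_sym q : rate q - rate (- q) = - q.
Proof.
have h1 := rate_sym_le q; have h2 := rate_sym_le (- q); rewrite opprK in h2.
by apply/eqP; rewrite eq_le; apply/andP; split; lra.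
Qed.

Lemma STxy_rate_ge x T q : 0 < T -> ((rate q)%:E <= STxy V b x x T q * (T^-1)%:E)%E.
Proof.
move=> T0; rewrite lee_pdivlMr// -EFinM; apply: STxy_ge => // E.
exact: rate_le_loop.
Qed.

Lemma STxy_rate_le x T q (k : R) : 0 < T -> reach x x T (q * T / 2) (k * T) ->
  (STxy V b x x T q * (T^-1)%:E <= k%:E)%E.
Proof.
by move=> T0 h; rewrite lee_pdivrMr// -EFinM; exact: STxy_le.
Qed.

Lemma sx_rate x q : sx V b x q = (rate q)%:E.
Proof.
apply/eqP; rewrite eq_le; apply/andP; split; last first.
  by apply: le_ereal_inf_tmp => _ [T T0 <-]; exact: STxy_rate_ge.
apply/lee_addgt0Pr => e e0.
have [T T0 H] := rate_upper q `|x| e0.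
apply: le_trans (STxy_rate_le T0 (H T x (lexx _) (lexx _))).
by apply: ereal_inf_lbound; exists T.
Qed.

(** The lower bound holds for every positive [T], since each loop bounds [rate]; the upper bound,
    from some time on, also makes the values finite. *)
Lemma STxy_rate_cvg x q :
  (STxy V b x x T q * (T^-1)%:E)%E @[T --> +oo] --> (rate q)%:E.
Proof.
have sandwich e : 0 < e -> \forall T \near +oo,
    ((rate q)%:E <= STxy V b x x T q * (T^-1)%:E <= (rate q + e)%:E)%E.
  move=> e0; have [T0 T00 H] := rate_upper q `|x| e0.
  near=> T.
  have TT0 : T0 <= T by near: T; apply: nbhs_pinfty_ge; exact: num_real.
  have Tp : 0 < T by lra.
  by rewrite STxy_rate_ge//= STxy_rate_le//; exact: (H T x TT0 (lexx _)).
have fin a c (u : \bar R) : (a%:E <= u <= c%:E)%E -> u \is a fin_num.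
  move=> /andP[au uc]; rewrite fin_numE; apply/andP; split; apply/eqP => ue;
  by move: au uc; rewrite ue.
apply/fine_cvgP; split.
  by apply: filterS (sandwich 1 ltr01) => T; exact: fin.
apply/cvgrPdist_le => e e0; apply: filterS (sandwich e e0) => T H.
have F := fin _ _ _ H; move: H; rewrite -(fineK F) !lee_fin => /andP[h1 h2] /=.
by rewrite distrC ger0_norm ?subr_ge0// lerBlDl.
Unshelve. all: by end_near. Qed.

End Values.

Theorem theorem5p1 (R : realType) (n : nat)
    (V : 'rV[R]_n -> R) (b : 'rV[R]_n -> 'rV[R]_n) :
  C2 V ->
  coercive_growth V ->
  C1field b ->
  bounded_field b ->
  bounded_first_derivatives b ->
  ~ gradient_field b ->
  (forall x, dotv (grad V x) (b x) = 0) ->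
  exists s : R -> R,
    (* (i) *)
    (forall x q, sx V b x q = (s q)%:E) /\
    (forall q1 q2 t : R, 0 <= t <= 1 ->
       s (t * q1 + (1 - t) * q2) <= t * s q1 + (1 - t) * s q2) /\
    (forall x q,
       (STxy V b x x T q * (T^-1)%:E)%E @[T --> +oo] --> (s q)%:E) /\
    (forall q, s q - s (- q) = - q) /\
    (* (ii) Gamma-convergence of s_T(q) := S^{x_T}_T(q) / T *)
    (forall xT : R -> 'rV[R]_n,
       (exists M : R, forall T, 0 < T -> enorm (xT T) <= M) ->
       forall (q : R) (Tn : nat -> R), Tn @ \oo --> +oo ->
         (forall qn : nat -> R, qn @ \oo --> q ->
            ((s q)%:E <= limn_einf
               (fun k => STx V b (xT (Tn k)) (Tn k) (qn k) * ((Tn k)^-1)%:E))%E) /\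
         (exists qn : nat -> R, qn @ \oo --> q /\
            (limn_esup
               (fun k => STx V b (xT (Tn k)) (Tn k) (qn k) * ((Tn k)^-1)%:E)
               <= (s q)%:E)%E)).
Proof.
move=> C2V cV C1b bb _ ngrad orth.
exists (rate V b); split; first by move=> x q; exact: sx_rate.
split; first by move=> q1 q2 t; exact: rate_convex.
split; first by move=> x q; exact: STxy_rate_cvg.
split; first by move=> q; exact: rate_sym.
move=> xT [M HM] q Tn Tny.
have xr T : 0 < T -> `|xT T| <= M.
  by move=> T0; apply: le_trans (mx_norm_le_enorm _) (HM _ T0).
split.
- move=> qn qnq; apply/lee_addgt0Pr => e e0.
  have [T0 [d [d0 H]]] := lower_rate q M C2V cV C1b orth bb ngrad e0.
  rewrite -leeBlDr//; apply: limn_einf_ge_near; near=> k.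
  have Tk1 : 1 <= Tn k by near: k; exact/(cvgryPge _).1.
  have Tk : T0 <= Tn k by near: k; exact/(cvgryPge _).1.
  have Tp : 0 < Tn k by lra.
  have qk : `|qn k - q| <= d.
    rewrite distrC; near: k; exact: (cvgrPdist_le _ _).1.
  rewrite lee_pdivlMr// -EFinB -EFinM; apply: STx_ge => // y E.
  by apply: H => //; exact: xr.
(* A constant sequence suffices: [rate_upper] is uniform on the ball of radius [M] containing the
   base points, and loops compete in the infimum with free endpoint. *)
- exists (fun=> q); split; first exact: cvg_cst.
  apply/lee_addgt0Pr => e e0.
  have [T0 T00 H] := rate_upper C2V C1b orth bb ngrad q M e0.
  apply: limn_esup_le_near; near=> k.
  have Tk : T0 <= Tn k by near: k; exact/(cvgryPge _).1.
  have Tp : 0 < Tn k by lra.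
  rewrite -EFinD.
  apply: le_trans (STxy_rate_le C2V C1b Tp (H _ _ Tk (xr _ Tp))).
  by apply: lee_wpmul2r; [rewrite lee_fin invr_ge0 ltW|exact: STx_le_STxy].
Unshelve. all: by end_near. Qed.
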